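(* Let $k$ be an odd integer, $|\gamma|\le1$ and $x\in\mathbb R$. Then $$D_\gamma^1[\varphi_k](x)=\frac{ke^{-i\gamma\frac\pi2}(x+i)^k}{(1+x^2)^{1+k/2}}+\cos\left(\gamma\frac\pi2\right)\left[\frac{2i}{\pi(2+k)}-\frac{8i}{\pi(4-k^2)}\,{}_2F_1\!\left(1,-1-\frac k2;2-\frac k2;\frac{(x+i)^2}{1+x^2}\right)\right],$$ or, equivalently, $$D_\gamma^1[\varphi_k](x)=\cos\left(\gamma\frac\pi2\right)\Bigg[\frac{2i\,\mathrm{sgn}(k)}{\pi(2+|k|)}+\frac{2ik(x+i)^k\left[x(1+x^2)^{1/2}+\operatorname{arsinh}(x)\right]}{\pi(1+x^2)^{1+k/2}}$$ $$\qquad+\sum_{n=0}^{(|k|-1)/2}\frac{8ik(x+i)^{k-\mathrm{sgn}(k)(2n+1)}}{\pi(2n-1)(2n+1)(2n+3)(1+x^2)^{[k-\mathrm{sgn}(k)(2n+1)]/2}}\Bigg]-\sin\left(\gamma\frac\pi2\right)\frac{ik(x+i)^k}{(1+x^2)^{1+k/2}}.$$ Moreover, if $s\in(0,\pi)$, then $$D_\gamma^1[\varphi_k](\cot(s))=ke^{-i\gamma\frac\pi2}\sin^2(s)e^{iks}+\cos\left(\gamma\frac\pi2\right)\left[\frac{2i}{\pi(2+k)}-\frac{8i}{\pi(4-k^2)}\,{}_2F_1\!\left(1,-1-\frac k2;2-\frac k2;e^{i2s}\right)\right],$$ or, equivalently, $$D_\gamma^1[\varphi_k](\cot(s))=\cos\left(\gamma\frac\pi2\right)\Bigg[\frac{2i\,\mathrm{sgn}(k)}{\pi(2+|k|)}+\frac{2ike^{iks}}{\pi}\Bigg[\cos(s)+\sin^2(s)\ln\left(\cot\left(\frac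 s2\right)\right)$$ $$\qquad+\sum_{n=0}^{(|k|-1)/2}\frac{4e^{-i\,\mathrm{sgn}(k)(2n+1)s}}{(2n-1)(2n+1)(2n+3)}\Bigg]\Bigg]-\sin\left(\gamma\frac\pi2\right)ik\sin^2(s)e^{iks}.$$
   Context: For $k\in\mathbb Z$, $\varphi_k(x)=\frac{(x+i)^k}{(1+x^2)^{k/2}}$, $x\in\mathbb R$ (formally $\left(\frac{ix-1}{ix+1}\right)^{k/2}$), so that $\varphi_k(\cot(s))=e^{iks}$ for $s\in(0,\pi)$. The Riesz-Feller operator of order $1$ and skewness $\gamma$, $|\gamma|\le1$, is $$D_\gamma^1[u](x)=-\cos\left(\gamma\frac\pi2\right)(-\Delta)^{1/2}u(x)+\sin\left(\gamma\frac\pi2\right)u'(x),$$ where $(-\Delta)^{1/2}u(x)=\frac1\pi\,\mathrm{p.v.}\!\int_{-\infty}^\infty\frac{u(x)-u(x+y)}{|y|^2}dy$ is the half Laplacian. $D_\gamma^1[u](\cot(s))$ means $D_\gamma^1[u](x)$ evaluated at $x=\cot(s)$. ${}_2F_1(a,b;c;z)=\sum_{n\ge0}\frac{(a)_n(b)_n}{(c)_n}\frac{z^n}{n!}$ is the Gaussian hypergeometric function (the series converges absolutely for the arguments of modulus $1$ used here), with $(z)_n=z(z+1)\cdots(z+n-1)$, $(z)_0=1$. $\operatorname{arsinh}$ is the inverse hyperbolic sine, and $\mathrm{sgn}$ is the sign function. *)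

(* Defs.v *)
From Stdlib Require Export Reals ZArith.
From Coquelicot Require Export Coquelicot.
Open Scope R_scope.

Definition Cpowz (z : C) (k : Z) : C :=
  match k with
  | Z0 => RtoC 1
  | Zpos p => Cpow z (Pos.to_nat p)
  | Zneg p => Cinv (Cpow z (Pos.to_nat p))
  end.

Definition Cexp (z : C) : C :=
  Cmult (RtoC (exp (Re z))) (cos (Im z), sin (Im z)).

Definition cot (s : R) : R := cos s / sin s.

(* [Series] is only defined for real terms; [CSeries] sums real and imaginary
   parts separately, which gives the limit in [C] of the partial sums whenever
   they converge (see [is_series_CSeries]). *)
Definition CSeries (a : nat -> C) : C :=
  (Series (fun n => Re (a n)), Series (fun n => Im (a n))).

Lemma is_series_CSeries (a : nat -> C) (l : C) :
  is_series (K := R_AbsRing) (V := C_R_NormedModule) a l -> CSeries a = l.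
Proof.
  intros H.
  assert (Hp : forall N, Re (sum_n (G := C_R_NormedModule) a N)
                         = sum_n (fun n => Re (a n)) N /\
                         Im (sum_n (G := C_R_NormedModule) a N)
                         = sum_n (fun n => Im (a n)) N).
  { induction N as [|N [IH1 IH2]].
    - now rewrite !sum_O.
    - rewrite (sum_Sn (fun n => Re (a n))), (sum_Sn (fun n => Im (a n))),
        (sum_Sn (G := C_R_NormedModule) a), <- IH1, <- IH2.
      now split. }
  assert (Hl : forall P : C -> Prop, locally (T := C_R_NormedModule) l P ->
               eventually (fun N => P (sum_n (G := C_R_NormedModule) a N)))
    by (intros P HP; exact (H P HP)).
  unfold CSeries. destruct l as [x y]. f_equal; apply is_series_unique.
  - intros P [e He].
    destruct (Hl (fun z => P (Re z))) as [N HN].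
    + exists e. intros z [Hz _]. now apply He.
    + exists N. intros n Hn. specialize (HN n Hn).
      cbv beta in HN. rewrite (proj1 (Hp n)) in HN. exact HN.
  - intros P [e He].
    destruct (Hl (fun z => P (Im z))) as [N HN].
    + exists e. intros z [_ Hz]. now apply He.
    + exists N. intros n Hn. specialize (HN n Hn).
      cbv beta in HN. rewrite (proj2 (Hp n)) in HN. exact HN.
Qed.

Fixpoint Cpoch (z : C) (n : nat) : C :=
  match n with
  | O => RtoC 1
  | S m => Cmult (Cpoch z m) (Cplus z (RtoC (INR m)))
  end.

Definition hyp2F1 (a b c z : C) : C :=
  CSeries (fun n =>
    (Cpoch a n * Cpoch b n / Cpoch c n * (Cpow z n / RtoC (INR (fact n))))%C).

Definition phi (k : Z) (x : R) : C :=
  (Cpowz (RtoC x + Ci) k / RtoC (Rpower (1 + x ^ 2) (IZR k / 2)))%C.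

(* Principal value at [0] of the integral of [f] over the line: both tails
   converge for every cutoff [eps > 0], and their sum tends to [l] as
   [eps -> 0+]. *)
Definition is_pv_int (f : R -> C) (l : C) : Prop :=
  exists J : R -> C,
    (forall eps : R, 0 < eps ->
       exists l1 l2 : C,
         is_RInt_gen (V := C_R_NormedModule) f
           (Rbar_locally m_infty) (at_point (- eps)) l1 /\
         is_RInt_gen (V := C_R_NormedModule) f
           (at_point eps) (Rbar_locally p_infty) l2 /\
         J eps = Cplus l1 l2) /\
    filterlim J (at_right 0) (locally (T := C_R_NormedModule) l).

Definition is_half_laplacian (u : R -> C) (x : R) (l : C) : Prop :=
  exists I : C,
    is_pv_int (fun y => ((u x - u (x + y)%R) / RtoC (Rabs y ^ 2))%C) I /\
    l = (RtoC (1 / PI) * I)%C.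

(* [is_Riesz_Feller gamma u x l] reads: the order-1 Riesz-Feller operator of
   skewness [gamma] applied to [u] is defined at [x], with value [l]. *)
Definition is_Riesz_Feller (gamma : R) (u : R -> C) (x : R) (l : C) : Prop :=
  exists h d : C,
    is_half_laplacian u x h /\
    is_derive (K := R_AbsRing) (V := C_R_NormedModule) u x d /\
    l = (- RtoC (cos (gamma * (PI / 2))) * h
         + RtoC (sin (gamma * (PI / 2))) * d)%C.

(* Main.v *)
Require Import Defs.
From Stdlib Require Import Reals ZArith Lra Lia Psatz FunctionalExtensionality.
From Coquelicot Require Import Coquelicot.
Open Scope R_scope.

(** Put [x = cot s] with [0 < s < PI]; then [phi k x = exp (i k s)].  If
    [x + y = cot t] and [w = t - s], the integrand of the half Laplacian is
    [exp (i k s) (1 - exp (i k w)) / y^2], and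
    [sin^2 w / y^2 = sin^2 s / (1 + (x + y)^2)], where [1 / (1 + (x + y)^2)] is,
    up to sign, the derivative of [w] in [y].  So everything is an integral over
    the angle [w] against [1 / sin^2 w].

    For [k = 1] and [k = -1] the integral is elementary
    ([has_pv_1_minus_cos_turn], [has_pv_sin_turn]).  In [k], the second
    difference with step 2 of [(1 - exp (i k w)) / sin^2 w] is [4 exp (i k w)]:
    the singularity disappears and the integral of the difference is immediate
    ([has_pv_turn_wave]).  Hence the principal values for all odd [k], of both
    signs, follow by induction.  Writing the principal value as [- 2 i k V k],
    the second-order relation integrates to the first-order one
    [V (k + 2) - V k = (exp (- i (k + 2) s) - exp (- i k s)) / (k (k + 2))],
    which, with the value of [V (-1)], determines [V] on the odd integers (the
    predicate [recurrence]).  Any solution gives the operator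
    ([is_Riesz_Feller_phi]), so both closed formulas are reduced to this
    recurrence.

    The finite sum solves it by inspection ([recurrence_closed_form]).  For the
    hypergeometric formula, the parameters differ by three, so that
    [(b)_n / (b + 3)_n = b (b + 1) (b + 2) / ((b + n) (b + n + 1) (b + n + 2))]
    and the value is, up to elementary factors, the sum of
    [exp (i m s) / ((m - 2) m (m + 2))] over the odd [m >= - k].  Raising [k] by 2
    adds one term, which is again the recurrence, and only [k = -1] has to be
    summed ([is_series_cubic]).  Since [1 / ((m - 2) m (m + 2))] is one eighth of
    a second difference of [1 / m], summation by parts turns that series into
    the sum of [exp (i m s) / m] over the odd [m > 0], which is
    [ln (cot (s / 2)) / 2 + i PI / 4] ([lim_odd_harmonics]): the derivatives of
    the partial sums are explicit, the oscillating remainder vanishes after one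
    integration by parts, and the constant comes from the Leibniz series at
    [s = PI / 2]. *)

(** * Principal values from antiderivatives *)

(** A principal value given by an antiderivative [F] off the singularity: the
    integrals over both tails have the explicit sum [F (- e) - a + (b - F e)], so
    their limit as [e] tends to [0] is [b - a] once [F (- e) - F e] vanishes, even if
    [F] itself is unbounded there. *)
Definition has_pv (f : R -> R) (l : R) : Prop :=
  exists (F : R -> R) (a b : R),
    (forall y, y <> 0 -> is_derive F y (f y)) /\
    (forall y, y <> 0 -> continuous f y) /\
    filterlim F (Rbar_locally m_infty) (locally a) /\
    filterlim F (Rbar_locally p_infty) (locally b) /\
    filterlim (fun e => F (- e) - F e) (at_right 0) (locally 0) /\
    l = b - a.

Lemma filterlim_Rplus {T} {G : (T -> Prop) -> Prop} {FG : Filter G}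
  (f g : T -> R) (a b : R) :
  filterlim f G (locally a) -> filterlim g G (locally b) ->
  filterlim (fun t => f t + g t) G (locally (a + b)).
Proof.
  intros Hf Hg.
  exact (filterlim_comp_2 _ _ Rplus Hf Hg
           (filterlim_plus (K := R_AbsRing) (V := R_NormedModule) a b)).
Qed.

Lemma filterlim_Rscal {T} {G : (T -> Prop) -> Prop} {FG : Filter G}
  (c : R) (f : T -> R) (a : R) :
  filterlim f G (locally a) ->
  filterlim (fun t => c * f t) G (locally (c * a)).
Proof.
  intros Hf.
  exact (filterlim_comp _ _ _ f (fun u => c * u) G (locally a) (locally (c * a)) Hf
           (filterlim_scal_r (K := R_AbsRing) (V := R_NormedModule) c a)).
Qed.

Lemma has_pv_lincomb (c d : R) (f g : R -> R) (l m : R) :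
  has_pv f l -> has_pv g m ->
  has_pv (fun y => c * f y + d * g y) (c * l + d * m).
Proof.
  intros (F & a & b & HF & Cf & Ha & Hb & H0 & ->)
         (G & a' & b' & HG & Cg & Ha' & Hb' & H0' & ->).
  exists (fun y => c * F y + d * G y), (c * a + d * a'), (c * b + d * b').
  refine (conj _ (conj _ (conj _ (conj _ (conj _ _))))).
  - intros y Hy. apply (is_derive_plus (fun y => c * F y) (fun y => d * G y)).
    + now apply (is_derive_scal F y c), HF.
    + now apply (is_derive_scal G y d), HG.
  - intros y Hy. apply (continuous_plus (fun y => c * f y) (fun y => d * g y)).
    + now apply (continuous_scal_r c f y), Cf.
    + now apply (continuous_scal_r d g y), Cg.
  - apply filterlim_Rplus; apply filterlim_Rscal; assumption.
  - apply filterlim_Rplus; apply filterlim_Rscal; assumption.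
  - apply (filterlim_ext
      (fun e => c * (F (- e) - F e) + d * (G (- e) - G e))).
    + intros e; ring.
    + replace (locally 0) with (locally (c * 0 + d * 0)) by (f_equal; ring).
      apply filterlim_Rplus; apply filterlim_Rscal; assumption.
  - ring.
Qed.

Lemma has_pv_ext (f g : R -> R) (l m : R) :
  (forall y, y <> 0 -> f y = g y) -> l = m -> has_pv f l -> has_pv g m.
Proof.
  intros E <- (F & a & b & HF & Cf & H).
  exists F, a, b.
  refine (conj _ (conj _ (conj _ (conj _ (conj _ _))))); try apply H.
  - intros y Hy. rewrite <- (E y Hy). now apply HF.
  - intros y Hy.
    apply (continuous_ext_loc g f y); [| now apply Cf].
    exists (mkposreal (Rabs y) (Rabs_pos_lt _ Hy)). intros z Hz. apply E.
    intros ->. revert Hz. unfold ball; simpl; unfold AbsRing_ball, abs, minus, plus, opp; simpl.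
    rewrite Rplus_0_l, Rabs_Ropp. lra.
Qed.

Lemma has_pv_scal (c : R) (f : R -> R) (l : R) :
  has_pv f l -> has_pv (fun y => c * f y) (c * l).
Proof.
  intros H. refine (has_pv_ext _ _ _ _ _ _ (has_pv_lincomb c 0 f f l l H H));
    intros; ring.
Qed.

Lemma is_RInt_antideriv (F f : R -> R) (a b : R) :
  (forall y, Rmin a b <= y <= Rmax a b -> y <> 0) ->
  (forall y, y <> 0 -> is_derive F y (f y)) ->
  (forall y, y <> 0 -> continuous f y) ->
  is_RInt f a b (F b - F a).
Proof.
  intros Hab HF Cf.
  apply (is_RInt_derive F f a b); intros y Hy; [apply HF | apply Cf]; now apply Hab.
Qed.

Lemma has_pv_is_pv_int (f g : R -> R) (l m : R) :
  has_pv f l -> has_pv g m ->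
  is_pv_int (fun y => (f y, g y)) (l, m).
Proof.
  intros (F & a & b & HF & Cf & Ha & Hb & H0 & ->)
         (G & a' & b' & HG & Cg & Ha' & Hb' & H0' & ->).
  exists (fun e => Cplus (F (- e) - a, G (- e) - a') (b - F e, b' - G e)).
  split.
  - intros eps Heps.
    exists (F (- eps) - a, G (- eps) - a'), (b - F eps, b' - G eps).
    refine (conj _ (conj _ eq_refl)).
    + assert (HL : filterlim (fun u => (F (- eps) - F u, G (- eps) - G u))
                (Rbar_locally m_infty)
                (locally (T := C_R_NormedModule) (F (- eps) - a, G (- eps) - a'))).
      { apply filterlim_locally. intros e.
        specialize (Ha (ball a e) (locally_ball a e)).
        specialize (Ha' (ball a' e) (locally_ball a' e)).
        unfold filtermap in *.
        refine (filter_imp _ _ _ (filter_and _ _ Ha Ha')).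
        intros u [H1 H2].
        split; unfold ball in *; simpl in *; unfold AbsRing_ball, abs, minus, plus, opp in *;
          simpl in *.
        - replace (F (- eps) - F u + - (F (- eps) - a)) with (- (F u + - a)) by ring.
          now rewrite Rabs_Ropp.
        - replace (G (- eps) - G u + - (G (- eps) - a')) with (- (G u + - a')) by ring.
          now rewrite Rabs_Ropp. }
      intros P HP. specialize (HL P HP).
      apply (Filter_prod _ _ _ (fun u => u < - eps /\ P (F (- eps) - F u, G (- eps) - G u))
              (fun v => v = - eps)).
      * apply filter_and; [now exists (- eps) | exact HL].
      * reflexivity.
      * intros u v [Hu HPu] ->. simpl.
        exists (F (- eps) - F u, G (- eps) - G u). split; [|exact HPu].
        apply (is_RInt_fct_extend_pair (fun y => (f y, g y)));
          simpl; apply is_RInt_antideriv; auto;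
          rewrite Rmin_left, Rmax_right by lra; intros; lra.
    + assert (HL : filterlim (fun u => (F u - F eps, G u - G eps))
                (Rbar_locally p_infty)
                (locally (T := C_R_NormedModule) (b - F eps, b' - G eps))).
      { apply filterlim_locally. intros e.
        specialize (Hb (ball b e) (locally_ball b e)).
        specialize (Hb' (ball b' e) (locally_ball b' e)).
        unfold filtermap in *.
        refine (filter_imp _ _ _ (filter_and _ _ Hb Hb')).
        intros u [H1 H2].
        split; unfold ball in *; simpl in *; unfold AbsRing_ball, abs, minus, plus, opp in *;
          simpl in *.
        - now replace (F u - F eps + - (b - F eps)) with (F u + - b) by ring.
        - now replace (G u - G eps + - (b' - G eps)) with (G u + - b') by ring. }
      intros P HP. specialize (HL P HP).
      apply (Filter_prod _ _ _ (fun u => u = eps)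
              (fun u => eps < u /\ P (F u - F eps, G u - G eps))).
      * reflexivity.
      * apply filter_and; [now exists eps | exact HL].
      * intros u v -> [Hv HPv]. simpl.
        exists (F v - F eps, G v - G eps). split; [|exact HPv].
        apply (is_RInt_fct_extend_pair (fun y => (f y, g y)));
          simpl; apply is_RInt_antideriv; auto;
          rewrite Rmin_left, Rmax_right by lra; intros; lra.
  - apply filterlim_locally. intros e.
    specialize (H0 (ball 0 e) (locally_ball 0 e)).
    specialize (H0' (ball 0 e) (locally_ball 0 e)).
    unfold filtermap in *.
    refine (filter_imp _ _ _ (filter_and _ _ H0 H0')).
    intros u [H1 H2].
    split; unfold ball in *; simpl in *; unfold AbsRing_ball, abs, minus, plus, opp in *;
      simpl in *.
    + now replace (F (- u) - a + (b - F u) + - (b - a)) with (F (- u) - F u + - 0) by ring.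
    + now replace (G (- u) - a' + (b' - G u) + - (b' - a')) with (G (- u) - G u + - 0) by ring.
Qed.

(** * The rotation angle and the elementary principal values *)

Lemma one_plus_sq_pos x : 0 < 1 + x ^ 2.
Proof. pose proof (pow2_ge_0 x). lra. Qed.

Lemma one_plus_sq_neq_0 x : 1 + x ^ 2 <> 0.
Proof. pose proof (one_plus_sq_pos x). lra. Qed.

Lemma filterlim_atan_p : filterlim atan (Rbar_locally p_infty) (locally (PI / 2)).
Proof.
  apply filterlim_locally. intros e.
  pose proof (cond_pos e) as He. pose proof PI_RGT_0 as Hpi.
  (* Capping the tolerance at 1 keeps [d] in the range where [atan (tan d) = d]. *)
  set (d := PI / 2 - Rmin e 1).
  assert (Hd : - (PI / 2) < d < PI / 2).
  { unfold d. pose proof PI2_1. unfold PI2 in *.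
    assert (0 < Rmin e 1 <= 1) by (split; [apply Rmin_pos; lra | apply Rmin_r]).
    lra. }
  exists (tan d). intros u Hu.
  apply atan_increasing in Hu. rewrite atan_tan in Hu by lra.
  pose proof (atan_bound u). pose proof (Rmin_l e 1).
  unfold ball; simpl; unfold AbsRing_ball, abs, minus, plus, opp; simpl.
  apply Rabs_def1; unfold d in *; lra.
Qed.

Lemma filterlim_atan_m : filterlim atan (Rbar_locally m_infty) (locally (- (PI / 2))).
Proof.
  apply (filterlim_ext (fun u => - atan (- u))).
  { intros u. rewrite atan_opp. ring. }
  apply (filterlim_comp _ _ _ (fun u => atan (- u)) Ropp _ (locally (PI / 2))).
  - apply (filterlim_comp _ _ _ Ropp atan _ (Rbar_locally p_infty)).
    + exact (filterlim_Rbar_opp m_infty).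
    + exact filterlim_atan_p.
  - exact (filterlim_opp (K := R_AbsRing) (V := R_NormedModule) (PI / 2)).
Qed.

(** If [x = cot s] and [x + y = cot t], this is [t - s]. *)
Definition turn (x y : R) : R := atan x - atan (x + y).

Definition acot (x : R) : R := PI / 2 - atan x.

Lemma acot_bound x : 0 < acot x < PI.
Proof. unfold acot. pose proof (atan_bound x). lra. Qed.

Lemma turn_bound x y : - PI < turn x y < PI.
Proof.
  unfold turn. pose proof (atan_bound x). pose proof (atan_bound (x + y)). lra.
Qed.

Lemma is_derive_turn x y : is_derive (turn x) y (- / (1 + (x + y) ^ 2)).
Proof.
  unfold turn. auto_derive; [easy|].
  replace ((x + y)²) with ((x + y) ^ 2) by (unfold Rsqr; ring).
  field. apply one_plus_sq_neq_0.
Qed.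

Lemma continuous_turn x y : continuous (turn x) y.
Proof. apply (ex_derive_continuous (turn x) y). eexists. apply is_derive_turn. Qed.

Lemma filterlim_turn_p x :
  filterlim (turn x) (Rbar_locally p_infty) (locally (- acot x)).
Proof.
  replace (- acot x) with (atan x + -1 * (PI / 2)) by (unfold acot; lra).
  apply (filterlim_ext (fun y => atan x + -1 * atan (x + y))).
  { intros y. unfold turn. ring. }
  apply filterlim_Rplus; [apply filterlim_const|]. apply filterlim_Rscal.
  apply (filterlim_comp _ _ _ (Rplus x) atan _ (Rbar_locally p_infty));
    [|exact filterlim_atan_p].
  intros P [M HM]. exists (M - x). intros y Hy. apply HM. lra.
Qed.

Lemma filterlim_turn_m x :
  filterlim (turn x) (Rbar_locally m_infty) (locally (PI - acot x)).
Proof.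
  replace (PI - acot x) with (atan x + -1 * (- (PI / 2))) by (unfold acot; lra).
  apply (filterlim_ext (fun y => atan x + -1 * atan (x + y))).
  { intros y. unfold turn. ring. }
  apply filterlim_Rplus; [apply filterlim_const|]. apply filterlim_Rscal.
  apply (filterlim_comp _ _ _ (Rplus x) atan _ (Rbar_locally m_infty));
    [|exact filterlim_atan_m].
  intros P [M HM]. exists (M - x). intros y Hy. apply HM. lra.
Qed.

Lemma sin_turn x y :
  sin (turn x y) * (sqrt (1 + x ^ 2) * sqrt (1 + (x + y) ^ 2)) = - y.
Proof.
  unfold turn. rewrite sin_minus, !sin_atan, !cos_atan, !Rsqr_pow2.
  assert (0 < sqrt (1 + x ^ 2)) by apply sqrt_lt_R0, one_plus_sq_pos.
  assert (0 < sqrt (1 + (x + y) ^ 2)) by apply sqrt_lt_R0, one_plus_sq_pos.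
  field. split; lra.
Qed.

Lemma sin2_turn x y :
  sin (turn x y) ^ 2 * ((1 + x ^ 2) * (1 + (x + y) ^ 2)) = y ^ 2.
Proof.
  replace (y ^ 2) with ((- y) ^ 2) by ring. rewrite <- (sin_turn x y).
  rewrite !Rpow_mult_distr, !pow2_sqrt by apply Rlt_le, one_plus_sq_pos. ring.
Qed.

Lemma one_plus_cos_pos w : - PI < w < PI -> 0 < 1 + cos w.
Proof.
  intros Hw. replace w with (2 * (w / 2)) by field. rewrite cos_2a_cos.
  assert (0 < cos (w / 2)) by (apply cos_gt_0; lra). nra.
Qed.

Lemma one_minus_cos_turn_pos x y : y <> 0 -> 0 < 1 - cos (turn x y).
Proof.
  intros Hy. pose proof (sin2_turn x y) as H. pose proof (sin2_cos2 (turn x y)) as H1.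
  rewrite !Rsqr_pow2 in H1. pose proof (COS_bound (turn x y)).
  destruct (Req_dec (cos (turn x y)) 1) as [E|]; [|lra].
  rewrite E in H1. assert (Z : sin (turn x y) ^ 2 = 0) by lra. rewrite Z in H.
  assert (0 < y ^ 2) by (apply pow2_gt_0; exact Hy). lra.
Qed.

Lemma continuous_no_jump (F : R -> R) :
  continuous F 0 -> filterlim (fun e => F (- e) - F e) (at_right 0) (locally 0).
Proof.
  intros CF.
  replace (locally 0) with (locally (F 0 + -1 * F 0)) by (f_equal; ring).
  apply (filterlim_ext (fun e => F (- e) + -1 * F e)); [intros e; ring|].
  refine (filterlim_filter_le_1 _ (filter_le_within (F := locally 0) _) _).
  apply filterlim_Rplus.
  - apply (filterlim_comp _ _ _ Ropp F _ (locally 0)); [|exact CF].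
    pose proof (filterlim_opp (K := R_AbsRing) (V := R_NormedModule) 0) as H.
    unfold opp in H; simpl in H. rewrite Ropp_0 in H. exact H.
  - apply filterlim_Rscal. exact CF.
Qed.

(** Change of variable to the angle, which runs over [(- acot x, PI - acot x)]; a
    regular integrand leaves nothing of the principal value. *)
Lemma has_pv_turn (x : R) (G g : R -> R) :
  (forall w, - PI < w < PI -> is_derive G w (g w)) ->
  (forall w, - PI < w < PI -> continuous g w) ->
  has_pv (fun y => g (turn x y) / (1 + (x + y) ^ 2))
    (G (PI - acot x) - G (- acot x)).
Proof.
  intros HG Hg. pose proof (acot_bound x) as Hs.
  assert (CG : forall w, - PI < w < PI -> continuous G w).
  { intros w Hw. apply (ex_derive_continuous G w). exists (g w). now apply HG. }
  assert (CF : continuous (fun y => -1 * G (turn x y)) 0).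
  { apply (continuous_scal_r (-1) (fun y => G (turn x y))).
    apply (continuous_comp (turn x) G); [apply continuous_turn|]. apply CG, turn_bound. }
  exists (fun y => -1 * G (turn x y)), (-1 * G (PI - acot x)), (-1 * G (- acot x)).
  refine (conj _ (conj _ (conj _ (conj _ (conj _ _))))).
  - intros y _.
    replace (g (turn x y) / (1 + (x + y) ^ 2))
      with (-1 * (- / (1 + (x + y) ^ 2) * g (turn x y))) by (field; apply one_plus_sq_neq_0).
    apply (is_derive_scal (fun y => G (turn x y))).
    apply (is_derive_comp G (turn x)); [apply HG, turn_bound | apply is_derive_turn].
  - intros y _.
    apply (continuous_mult (fun y => g (turn x y)) (fun y => / (1 + (x + y) ^ 2))).
    + apply (continuous_comp (turn x) g); [apply continuous_turn|]. apply Hg, turn_bound.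
    + apply (ex_derive_continuous (fun y => / (1 + (x + y) ^ 2))).
      auto_derive. pose proof (one_plus_sq_neq_0 (x + y)). simpl in *. auto.
  - apply filterlim_Rscal.
    apply (filterlim_comp _ _ _ (turn x) G _ (locally (PI - acot x))).
    + apply filterlim_turn_m.
    + apply CG. lra.
  - apply filterlim_Rscal.
    apply (filterlim_comp _ _ _ (turn x) G _ (locally (- acot x))).
    + apply filterlim_turn_p.
    + apply CG. lra.
  - exact (continuous_no_jump _ CF).
  - ring.
Qed.

(** This is [ln (cot (s / 2))] on [(0, PI)], written so that it is even in [s]: the
    angle it is applied to takes both signs. *)
Definition lcot (s : R) : R := / 2 * ln ((1 + cos s) / (1 - cos s)).

Lemma sin_sqr_factor t : sin t ^ 2 = (1 - cos t) * (1 + cos t).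
Proof. pose proof (sin2_cos2 t) as E. rewrite !Rsqr_pow2 in E. nra. Qed.

Lemma one_minus_cos_pos t : 0 < t < 2 * PI -> 0 < 1 - cos t.
Proof.
  intros Ht. pose proof (one_plus_cos_pos (PI - t) ltac:(lra)) as H.
  rewrite Rtrigo_facts.cos_pi_minus in H. lra.
Qed.

Lemma sin2_acot x : sin (acot x) ^ 2 = / (1 + x ^ 2).
Proof.
  unfold acot. rewrite sin_shift, cos_atan, Rsqr_pow2.
  pose proof (one_plus_sq_pos x). pose proof (sqrt_lt_R0 _ H).
  rewrite <- (pow2_sqrt (1 + x ^ 2)) at 2 by lra. field. lra.
Qed.

(** Trades the double pole at [y = 0] for one in the angle, leaving the Jacobian of
    [y |-> turn x y]. *)
Lemma sin2_turn_over_sq x y : y <> 0 ->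
  sin (turn x y) ^ 2 / y ^ 2 = sin (acot x) ^ 2 / (1 + (x + y) ^ 2).
Proof.
  intros Hy. rewrite sin2_acot, <- (sin2_turn x y).
  pose proof (one_plus_sq_neq_0 x). pose proof (one_plus_sq_neq_0 (x + y)).
  assert (sin (turn x y) <> 0).
  { intros E. pose proof (sin2_turn x y) as E1. rewrite E in E1.
    assert (0 < y ^ 2) by (apply pow2_gt_0; exact Hy). lra. }
  field. auto.
Qed.

Lemma has_pv_1_minus_cos_turn x :
  has_pv (fun y => (1 - cos (turn x y)) / y ^ 2) (2 * sin (acot x)).
Proof.
  pose proof (acot_bound x) as Hs.
  pose proof (one_plus_cos_pos (acot x) ltac:(lra)) as H1.
  pose proof (one_minus_cos_pos (acot x) ltac:(lra)) as H2.
  refine (has_pv_ext _ _ _ _ _ _ (has_pv_scal (sin (acot x) ^ 2) _ _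
    (has_pv_turn x (fun w => sin w / (1 + cos w)) (fun w => / (1 + cos w)) _ _))).
  - intros y Hy. cbv beta.
    pose proof (one_plus_cos_pos _ (turn_bound x y)) as H3.
    transitivity (sin (turn x y) ^ 2 / y ^ 2 / (1 + cos (turn x y))).
    + rewrite sin2_turn_over_sq by exact Hy. pose proof (one_plus_sq_neq_0 (x + y)).
      field. split; lra.
    + rewrite sin_sqr_factor. field. lra.
  - cbv beta. rewrite Rtrigo_facts.cos_pi_minus, Rtrigo_facts.sin_pi_minus, sin_neg, cos_neg.
    rewrite sin_sqr_factor. field. lra.
  - intros w Hw. pose proof (one_plus_cos_pos w Hw).
    auto_derive; [lra|].
    transitivity ((cos w * (1 + cos w) + sin w ^ 2) / (1 + cos w) ^ 2); [field; lra|].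
    rewrite sin_sqr_factor. field. lra.
  - intros w Hw. pose proof (one_plus_cos_pos w Hw).
    apply (ex_derive_continuous (fun w => / (1 + cos w))). auto_derive. lra.
Qed.

Lemma continuous_lcot w : 0 < 1 + cos w -> 0 < 1 - cos w -> continuous lcot w.
Proof.
  intros H1 H2. apply (ex_derive_continuous lcot w). unfold lcot. auto_derive.
  split; [lra|]. split; [|easy]. apply Rdiv_lt_0_compat; lra.
Qed.

Lemma is_derive_lcot w : 0 < 1 + cos w -> 0 < 1 - cos w ->
  is_derive lcot w (- (sin w / sin w ^ 2)).
Proof.
  intros H1 H2. unfold lcot. auto_derive.
  - split; [lra|]. split; [|easy]. apply Rdiv_lt_0_compat; lra.
  - rewrite sin_sqr_factor. field. lra.
Qed.

Lemma lcot_opp w : lcot (- w) = lcot w.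
Proof. unfold lcot. now rewrite cos_neg. Qed.

Lemma lcot_pi_minus w : 0 < 1 + cos w -> 0 < 1 - cos w -> lcot (PI - w) = - lcot w.
Proof.
  intros H1 H2. unfold lcot. rewrite Rtrigo_facts.cos_pi_minus.
  rewrite (ln_div (1 + - cos w)), (ln_div (1 + cos w)) by lra.
  replace (1 - - cos w) with (1 + cos w) by ring.
  replace (1 + - cos w) with (1 - cos w) by ring. ring.
Qed.

(** The integrand has a simple pole at [y = 0], and the antiderivative
    [lcot (turn x y)] is unbounded there.  Its divergent part [- ln (y ^ 2) / 2] is
    even in [y], which is why the two sides cancel. *)
Lemma has_pv_sin_turn x :
  has_pv (fun y => sin (turn x y) / y ^ 2)
    (2 * sin (acot x) ^ 2 * lcot (acot x)).
Proof.
  pose proof (acot_bound x) as Hs.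
  pose proof (one_plus_cos_pos (acot x) ltac:(lra)) as H1.
  pose proof (one_minus_cos_pos (acot x) ltac:(lra)) as H2.
  set (c := sin (acot x) ^ 2).
  exists (fun y => c * lcot (turn x y)), (c * lcot (PI - acot x)), (c * lcot (- acot x)).
  refine (conj _ (conj _ (conj _ (conj _ (conj _ _))))).
  - intros y Hy. pose proof (one_plus_cos_pos _ (turn_bound x y)). pose proof (one_minus_cos_turn_pos x y Hy).
    replace (sin (turn x y) / y ^ 2)
      with (c * (- / (1 + (x + y) ^ 2) * - (sin (turn x y) / sin (turn x y) ^ 2))).
    { apply (is_derive_scal (fun y => lcot (turn x y))).
      apply (is_derive_comp lcot (turn x)); [now apply is_derive_lcot | apply is_derive_turn]. }
    transitivity (sin (acot x) ^ 2 / (1 + (x + y) ^ 2) * sin (turn x y) / sin (turn x y) ^ 2).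
    + unfold c, Rdiv. ring.
    + rewrite <- sin2_turn_over_sq by exact Hy.
      assert (sin (turn x y) ^ 2 <> 0) by (rewrite sin_sqr_factor; nra).
      field. split; [exact Hy|]. intros E. apply H3. rewrite E. ring.
  - intros y Hy. apply (ex_derive_continuous (fun y => sin (turn x y) / y ^ 2)).
    auto_derive. split; [eexists; apply is_derive_turn|]. split; [|easy]. exact (pow_nonzero y 2 Hy).
  - apply filterlim_Rscal. eapply filterlim_comp; [apply filterlim_turn_m|].
    apply continuous_lcot; rewrite Rtrigo_facts.cos_pi_minus; lra.
  - apply filterlim_Rscal. eapply filterlim_comp; [apply filterlim_turn_p|].
    apply continuous_lcot; rewrite cos_neg; lra.
  (* [M] is the antiderivative with its even divergent part [- c / 2 * ln (y ^ 2)] removed. *)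
  - set (M := fun y => c * / 2 * ln ((1 + x ^ 2) * (1 + (x + y) ^ 2) * (1 + cos (turn x y)) ^ 2)).
    apply (filterlim_within_ext _ (fun e => M (- e) - M e)).
    + assert (HM : forall y, y <> 0 -> c * lcot (turn x y) = M y - c * / 2 * ln (y ^ 2)).
      { intros y Hy. unfold M, lcot.
        pose proof (one_plus_cos_pos _ (turn_bound x y)). pose proof (one_minus_cos_turn_pos x y Hy).
        pose proof (one_plus_sq_pos x). pose proof (one_plus_sq_pos (x + y)).
        assert (0 < y ^ 2) by (apply pow2_gt_0; exact Hy).
        rewrite (ln_div (1 + _)) by lra.
        rewrite <- (sin2_turn x y), sin_sqr_factor.
        replace ((1 + cos (turn x y)) ^ 2)
          with ((1 + cos (turn x y)) * (1 + cos (turn x y))) by ring.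
        rewrite !ln_mult by (repeat apply Rmult_lt_0_compat; lra). field. }
      intros e He. rewrite !HM by lra. replace ((- e) ^ 2) with (e ^ 2) by ring. ring.
    + apply continuous_no_jump.
      apply (ex_derive_continuous M 0). unfold M.
      auto_derive. split; [eexists; apply is_derive_turn|]. split; [|easy].
      pose proof (one_plus_cos_pos _ (turn_bound x 0)).
      pose proof (one_plus_sq_pos x). pose proof (one_plus_sq_pos (x + 0)).
      simpl in *. repeat apply Rmult_lt_0_compat; lra.
  - rewrite lcot_opp, lcot_pi_minus by assumption. unfold c. ring.
Qed.

(** * Principal values of all odd modes *)

Definition cis (t : R) : C := (cos t, sin t).

Lemma cis_plus a b : cis (a + b) = (cis a * cis b)%C.
Proof.
  unfold cis. rewrite cos_plus, sin_plus. apply injective_projections; simpl; ring.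
Qed.

(** Why second differences of step 2 in the frequency kill the double pole:
    [exp (2 i b) - 2 + exp (- 2 i b) = - 4 sin^2 b]. *)
Lemma cis_second_diff a b :
  (cis (a + 2 * b) + cis (a - 2 * b) = (2 - 4 * sin b ^ 2)%R * cis a)%C.
Proof.
  replace (2 - 4 * sin b ^ 2) with (2 * cos (2 * b)) by (rewrite cos_2a_sin; ring).
  unfold cis. rewrite cos_plus, sin_plus, cos_minus, sin_minus.
  apply injective_projections; simpl; ring.
Qed.

(** Characterizes [V] on the odd integers, which is why every closed formula can be
    checked through it.  The principal value for frequency [k] is
    [- 2 i k V k], with [acot x = s]. *)
Definition recurrence (s : R) (V : Z -> C) : Prop :=
  V (-1)%Z = (sin s ^ 2 * lcot s, - sin s) /\
  forall k, Z.Odd k ->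
    V (k + 2)%Z = (V k + (cis (- IZR (k + 2) * s) - cis (- IZR k * s))
                          / RtoC (IZR k * IZR (k + 2)))%C.

Definition pv_value (V : Z -> C) (k : Z) : C := (- (2 * Ci * IZR k * V k))%C.

Lemma IZR_odd_neq_0 k : Z.Odd k -> IZR k <> 0.
Proof. intros [m ->]. apply not_0_IZR. lia. Qed.

Lemma RtoC_neq_0 r : r <> 0 -> RtoC r <> 0%C.
Proof. intros H E. apply H. now injection E. Qed.

(** The factor [k] in [pv_value] is what makes the first-order recurrence integrate
    the second-order one: [(k + 2) (V (k + 2) - V k) - (k - 2) (V k - V (k - 2))] has the
    denominators cancelled down to [k]. *)
Lemma pv_value_second_diff s V k : recurrence s V -> Z.Odd k ->
  (pv_value V (k + 2) + pv_value V (k - 2) = 2 * pv_value V k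
     + (8 * sin s ^ 2 / IZR k)%R * (Ci * cis (- IZR k * s)))%C.
Proof.
  intros [_ HV] Hk.
  assert (Hm : Z.Odd (k - 2)) by (destruct Hk as [m ->]; exists (m - 1)%Z; lia).
  assert (Hp : Z.Odd (k + 2)) by (destruct Hk as [m ->]; exists (m + 1)%Z; lia).
  pose proof (HV _ Hk) as E1. pose proof (HV _ Hm) as E2.
  replace (k - 2 + 2)%Z with k in E2 by lia.
  pose proof (cis_second_diff (- IZR k * s) (- s)) as E3.
  rewrite sin_neg in E3.
  replace (- IZR k * s + 2 * - s) with (- IZR (k + 2) * s) in E3 by (rewrite plus_IZR; ring).
  replace (- IZR k * s - 2 * - s) with (- IZR (k - 2) * s) in E3 by (rewrite minus_IZR; ring).
  assert (E4 : cis (- IZR (k - 2) * s)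
    = ((2 - 4 * (- sin s) ^ 2)%R * cis (- IZR k * s) - cis (- IZR (k + 2) * s))%C).
  { rewrite <- E3. ring. }
  rewrite E4 in E2. clear E3 E4.
  pose proof (IZR_odd_neq_0 _ Hk) as H1. pose proof (IZR_odd_neq_0 _ Hm) as H2.
  pose proof (IZR_odd_neq_0 _ Hp) as H3.
  unfold pv_value. rewrite E1.
  assert (E5 : V (k - 2)%Z = (V k - ((cis (- IZR k * s) -
      ((2 - 4 * (- sin s) ^ 2)%R * cis (- IZR k * s) - cis (- IZR (k + 2) * s))) /
     (IZR (k - 2) * IZR k)%R))%C).
  { rewrite E2. ring. }
  rewrite E5. clear E1 E2 E5.
  rewrite minus_IZR, plus_IZR in *.
  generalize (cis (- (IZR k + 2) * s)), (cis (- IZR k * s)), (V k). intros a b v.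
  apply injective_projections; simpl; field; repeat split; assumption.
Qed.

(** Here the double pole has been cancelled by [sin^2].  Oddness of [k] enters
    through the antiperiodicity [exp (i k (w + PI)) = - exp (i k w)], by which the two
    end values of the angle contribute equally. *)
Lemma has_pv_turn_wave x k th : Z.Odd k ->
  has_pv (fun y => sin (turn x y) ^ 2 * cos (IZR k * turn x y + th) / y ^ 2)
    (- (2 * sin (acot x) ^ 2 * sin (th - IZR k * acot x) / IZR k)).
Proof.
  intros Hk. pose proof (IZR_odd_neq_0 _ Hk) as H1.
  refine (has_pv_ext _ _ _ _ _ _ (has_pv_scal (sin (acot x) ^ 2) _ _
    (has_pv_turn x (fun w => sin (IZR k * w + th) / IZR k)
       (fun w => cos (IZR k * w + th)) _ _))).
  - intros y Hy. cbv beta.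
    transitivity (sin (turn x y) ^ 2 / y ^ 2 * cos (IZR k * turn x y + th)).
    + rewrite sin2_turn_over_sq by exact Hy. unfold Rdiv. ring.
    + unfold Rdiv. ring.
  - cbv beta. destruct Hk as [m Em].
    replace (IZR k * (PI - acot x) + th)
      with ((th - IZR k * acot x) + PI + 2 * IZR m * PI)
      by (rewrite Em, plus_IZR, mult_IZR; ring).
    replace (sin (th - IZR k * acot x + PI + 2 * IZR m * PI))
      with (- sin (th - IZR k * acot x)).
    + replace (IZR k * - acot x + th) with (th - IZR k * acot x) by ring. field. exact H1.
    + rewrite <- neg_sin. destruct m as [|p|p].
      * f_equal. ring.
      * replace (IZR (Z.pos p)) with (INR (Pos.to_nat p)) by (rewrite INR_IPR; reflexivity).
        now rewrite sin_period.
      * replace (IZR (Z.neg p)) with (- INR (Pos.to_nat p)) by (rewrite INR_IPR; reflexivity).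
        rewrite <- (sin_period (_ + _ + _) (Pos.to_nat p)). f_equal. ring.
  - intros w _. auto_derive; [easy|]. field. exact H1.
  - intros w _. apply (ex_derive_continuous (fun w => cos (IZR k * w + th))).
    now auto_derive.
Qed.

(** The free phase [th] carries real and imaginary parts together through the
    induction, and also absorbs the factor [exp (i k s)]. *)
Definition pv_mode (x : R) (V : Z -> C) (k : Z) : Prop :=
  forall th, has_pv (fun y => (cos th - cos (IZR k * turn x y + th)) / y ^ 2)
               (Re (cis th * pv_value V k)%C).

Lemma mode_second_diff k w th :
  cos (IZR (k + 2) * w + th) + cos (IZR (k - 2) * w + th)
  = 2 * cos (IZR k * w + th) - 4 * (sin w ^ 2 * cos (IZR k * w + th)).
Proof.
  pose proof (cis_second_diff (IZR k * w + th) w) as E.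
  apply (f_equal fst) in E. simpl in E. rewrite plus_IZR, minus_IZR.
  replace ((IZR k + 2) * w + th) with (IZR k * w + th + 2 * w) by ring.
  replace ((IZR k - 2) * w + th) with (IZR k * w + th - 2 * w) by ring.
  rewrite E. ring.
Qed.

Lemma Re_pv_value_second_diff s V k th : recurrence s V -> Z.Odd k ->
  Re (cis th * pv_value V (k + 2))%C + Re (cis th * pv_value V (k - 2))%C
  = 2 * Re (cis th * pv_value V k)%C + 4 * (- (2 * sin s ^ 2 * sin (th - IZR k * s) / IZR k)).
Proof.
  intros HV Hk. pose proof (IZR_odd_neq_0 _ Hk) as H1.
  pose proof (f_equal (fun z => Re (cis th * z)%C) (pv_value_second_diff s V k HV Hk)) as E.
  transitivity (Re (cis th * (pv_value V (k + 2) + pv_value V (k - 2)))%C); [simpl; ring|].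
  cbv beta in E. rewrite E. rewrite sin_minus. unfold cis.
  replace (- IZR k * s) with (- (IZR k * s)) by ring. rewrite cos_neg, sin_neg.
  simpl. field. exact H1.
Qed.

(** The recurrence in [k] runs in both directions, hence the two cases. *)
Lemma pv_mode_step x V k i j : recurrence (acot x) V -> Z.Odd k ->
  (i = k - 2 /\ j = k + 2 \/ i = k + 2 /\ j = k - 2)%Z ->
  pv_mode x V k -> pv_mode x V i -> pv_mode x V j.
Proof.
  intros HV Hk Hij A B th.
  refine (has_pv_ext _ _ _ _ _ _
    (has_pv_lincomb 1 4 _ _ _ _ (has_pv_lincomb 2 (-1) _ _ _ _ (A th) (B th))
       (has_pv_turn_wave x k th Hk))).
  - intros y Hy. pose proof (mode_second_diff k (turn x y) th) as E.
    replace (cos (IZR j * turn x y + th)) with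
      (2 * cos (IZR k * turn x y + th)
       - 4 * (sin (turn x y) ^ 2 * cos (IZR k * turn x y + th))
       - cos (IZR i * turn x y + th))
      by (destruct Hij as [[-> ->]|[-> ->]]; lra).
    field. exact Hy.
  - pose proof (Re_pv_value_second_diff (acot x) V k th HV Hk).
    destruct Hij as [[-> ->]|[-> ->]]; lra.
Qed.

(** Two-sided induction on two consecutive odd frequencies, from [1] and [-1]. *)
Lemma pv_mode_odd x V k : recurrence (acot x) V -> Z.Odd k -> pv_mode x V k.
Proof.
  intros HV [m ->].
  enough (H : pv_mode x V (2 * m + 1) /\ pv_mode x V (2 * m + 1 - 2)) by apply H.
  induction m as [|m [A B]|m [A B]] using Z.peano_ind.
  - assert (E : (2 * 0 + 1 - 2 = -1)%Z) by lia. rewrite E; clear E.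
    assert (E : (2 * 0 + 1 = 1)%Z) by lia. rewrite E; clear E.
    destruct HV as [Hb HV].
    assert (H1 : V 1%Z = (sin (acot x) ^ 2 * lcot (acot x), sin (acot x))).
    { specialize (HV (-1)%Z). simpl in HV. rewrite HV by (now exists (-1)%Z).
      rewrite Hb. unfold cis. replace (- -1 * acot x) with (acot x) by ring.
      replace (- (1) * acot x) with (- acot x) by ring. rewrite cos_neg, sin_neg.
      apply injective_projections; simpl; field. }
    split; intros th.
    + refine (has_pv_ext _ _ _ _ _ _ (has_pv_lincomb (cos th) (sin th) _ _ _ _
        (has_pv_1_minus_cos_turn x) (has_pv_sin_turn x))).
      * intros y Hy. rewrite Rmult_1_l, cos_plus. field. exact Hy.
      * unfold pv_value. rewrite H1. simpl. ring.
    + refine (has_pv_ext _ _ _ _ _ _ (has_pv_lincomb (cos th) (- sin th) _ _ _ _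
        (has_pv_1_minus_cos_turn x) (has_pv_sin_turn x))).
      * intros y Hy. replace (-1 * turn x y + th) with (th - turn x y) by ring.
        rewrite cos_minus. field. exact Hy.
      * unfold pv_value. rewrite Hb. simpl. ring.
  - replace (2 * Z.succ m + 1)%Z with (2 * m + 1 + 2)%Z by lia.
    replace (2 * m + 1 + 2 - 2)%Z with (2 * m + 1)%Z by lia.
    split; [|exact A].
    apply (pv_mode_step x V (2 * m + 1) (2 * m + 1 - 2)); try assumption; [now exists m|].
    now left.
  - replace (2 * Z.pred m + 1)%Z with (2 * m + 1 - 2)%Z by lia.
    split; [exact B|].
    apply (pv_mode_step x V (2 * m + 1 - 2) (2 * m + 1)); try assumption.
    + exists (m - 1)%Z. lia.
    + right. split; lia.
Qed.

(** * The operator on [phi k], up to a solution of the recurrence *)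

(** Holds for [r = 0] as well since [/ 0 = 0]; this covers the value at [y = 0] of
    the integrand of the half Laplacian. *)
Lemma Cdiv_RtoC (z : C) (r : R) : (z / RtoC r)%C = (fst z / r, snd z / r).
Proof.
  destruct (Req_dec r 0) as [->|Hr].
  - apply injective_projections; simpl; unfold Rdiv; rewrite !Rmult_0_l, Rplus_0_l, !Rinv_0;
      ring.
  - apply injective_projections; simpl; field; exact Hr.
Qed.

Lemma cis_inv t : (/ cis t)%C = cis (- t).
Proof.
  unfold cis, Cinv; simpl. rewrite cos_neg, sin_neg.
  replace (cos t * (cos t * 1) + sin t * (sin t * 1)) with 1
    by (pose proof (sin2_cos2 t); unfold Rsqr in *; lra).
  apply injective_projections; simpl; field.
Qed.

Lemma Cpow_polar r t n : 0 < r ->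
  Cpow (RtoC r * cis t) n = (RtoC (exp (INR n * ln r)) * cis (INR n * t))%C.
Proof.
  intros Hr. induction n as [|n IH].
  - simpl. rewrite !Rmult_0_l, exp_0. unfold cis. rewrite cos_0, sin_0.
    apply injective_projections; simpl; ring.
  - rewrite S_INR. change (Cpow (RtoC r * cis t) (S n))
      with ((RtoC r * cis t) * Cpow (RtoC r * cis t) n)%C.
    rewrite IH. rewrite !Rmult_plus_distr_r, !Rmult_1_l, exp_plus, (cis_plus (INR n * t)).
    rewrite exp_ln, RtoC_mult by exact Hr. ring.
Qed.

Lemma Cpowz_polar r t k : 0 < r ->
  Cpowz (RtoC r * cis t) k = (RtoC (exp (IZR k * ln r)) * cis (IZR k * t))%C.
Proof.
  intros Hr. destruct k as [|p|p]; simpl Cpowz.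
  - rewrite !Rmult_0_l, exp_0. unfold cis. rewrite cos_0, sin_0.
    apply injective_projections; simpl; ring.
  - rewrite Cpow_polar by exact Hr. rewrite INR_IPR. reflexivity.
  - rewrite Cpow_polar by exact Hr. rewrite INR_IPR.
    change (IZR (Z.neg p)) with (- IPR p).
    rewrite !Ropp_mult_distr_l_reverse, exp_Ropp, <- cis_inv, RtoC_inv.
    + field. split.
      * intros E. pose proof (cis_plus (IPR p * t) (- (IPR p * t))) as H.
        rewrite E, Rplus_opp_r in H. unfold cis in H. rewrite cos_0 in H.
        apply (f_equal fst) in H. simpl in H. lra.
      * apply RtoC_neq_0, Rgt_not_eq, exp_pos.
    + apply Rgt_not_eq, exp_pos.
Qed.

Lemma x_plus_i_polar x : (RtoC x + Ci)%C = (RtoC (sqrt (1 + x ^ 2)) * cis (acot x))%C.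
Proof.
  unfold cis, acot. rewrite cos_shift, sin_shift, sin_atan, cos_atan, Rsqr_pow2.
  pose proof (sqrt_lt_R0 _ (one_plus_sq_pos x)).
  apply injective_projections; simpl; field; simpl in *; lra.
Qed.

Lemma Rpower_half x a :
  Rpower (1 + x ^ 2) (a / 2) = exp (a * ln (sqrt (1 + x ^ 2))).
Proof.
  pose proof (sqrt_lt_R0 _ (one_plus_sq_pos x)) as H.
  unfold Rpower. rewrite <- (pow2_sqrt (1 + x ^ 2)) at 1 by apply Rlt_le, one_plus_sq_pos.
  rewrite ln_pow by exact H. f_equal. simpl INR. field.
Qed.

Lemma phi_cis k x : phi k x = cis (IZR k * acot x).
Proof.
  unfold phi. rewrite Rpower_half, x_plus_i_polar.
  rewrite Cpowz_polar by apply sqrt_lt_R0, one_plus_sq_pos.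
  field. apply RtoC_neq_0, Rgt_not_eq, exp_pos.
Qed.

Lemma is_derive_phi k x :
  is_derive (K := R_AbsRing) (V := C_R_NormedModule) (phi k) x
    (- (Ci * IZR k * RtoC (sin (acot x) ^ 2) * cis (IZR k * acot x)))%C.
Proof.
  apply (is_derive_ext (K := R_AbsRing) (V := C_R_NormedModule)
    (fun x => plus (scal (cos (IZR k * acot x)) (1, 0)) (scal (sin (IZR k * acot x)) (0, 1)))).
  { intros t. rewrite phi_cis. apply injective_projections; simpl;
      unfold plus, scal; simpl; unfold mult; simpl; ring. }
  rewrite sin2_acot.
  replace (- (Ci * IZR k * RtoC (/ (1 + x ^ 2)) * cis (IZR k * acot x)))%C
    with (plus (G := C_R_NormedModule)
      (scal (IZR k * sin (IZR k * acot x) / (1 + x ^ 2)) (1, 0))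
      (scal (- (IZR k * cos (IZR k * acot x) / (1 + x ^ 2))) (0, 1))).
  2:{ apply injective_projections; unfold plus, scal; simpl; unfold scal, plus; simpl;
      unfold mult; simpl;
      field; pose proof (one_plus_sq_neq_0 x); nra. }
  apply (is_derive_plus (K := R_AbsRing) (V := C_R_NormedModule)).
  - apply (is_derive_scal_l (K := R_AbsRing) (V := C_R_NormedModule)
      (fun x => cos (IZR k * acot x))).
    unfold acot. auto_derive; [easy|].
    fold (PI / 2 - atan x). field. apply one_plus_sq_neq_0.
  - apply (is_derive_scal_l (K := R_AbsRing) (V := C_R_NormedModule)
      (fun x => sin (IZR k * acot x))).
    unfold acot. auto_derive; [easy|].
    fold (PI / 2 - atan x). field. apply one_plus_sq_neq_0.
Qed.

Lemma is_half_laplacian_phi k x V : Z.Odd k -> recurrence (acot x) V ->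
  is_half_laplacian (phi k) x
    (RtoC (1 / PI) * (cis (IZR k * acot x) * pv_value V k))%C.
Proof.
  intros Hk HV. eexists. split; [|reflexivity].
  set (th := IZR k * acot x).
  pose proof (has_pv_is_pv_int _ _ _ _ (pv_mode_odd x V k HV Hk th)
                (pv_mode_odd x V k HV Hk (th - PI / 2))) as H.
  replace (cis th * pv_value V k)%C
    with (Re (cis th * pv_value V k)%C, Re (cis (th - PI / 2) * pv_value V k)%C).
  2:{ unfold cis. rewrite cos_minus, sin_minus, cos_PI2, sin_PI2.
      apply injective_projections; simpl; ring. }
  refine (eq_ind _ (fun f => is_pv_int f _) H _ _).
  apply functional_extensionality. intros y.
  rewrite Cdiv_RtoC, !phi_cis, pow2_abs.
  replace (IZR k * acot (x + y)) with (IZR k * turn x y + th)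
    by (unfold th, turn, acot; ring).
  fold th. replace (IZR k * turn x y + (th - PI / 2))
    with ((IZR k * turn x y + th) - PI / 2) by ring.
  unfold cis. rewrite !(cos_minus _ (PI / 2)), cos_PI2, sin_PI2.
  apply injective_projections; simpl; unfold Rdiv; ring.
Qed.

Lemma is_Riesz_Feller_phi gamma k x V : Z.Odd k -> recurrence (acot x) V ->
  is_Riesz_Feller gamma (phi k) x
    (RtoC (cos (gamma * (PI / 2))) * (2 * Ci * IZR k * cis (IZR k * acot x) / PI * V k)
     - RtoC (sin (gamma * (PI / 2)))
       * (Ci * IZR k * RtoC (sin (acot x) ^ 2) * cis (IZR k * acot x)))%C.
Proof.
  intros Hk HV.
  eexists. eexists. split; [exact (is_half_laplacian_phi k x V Hk HV)|].
  split; [apply is_derive_phi|]. unfold pv_value.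
  rewrite RtoC_div by apply PI_neq0. field. apply RtoC_neq_0, PI_neq0.
Qed.

(** * The cubic odd-harmonic series *)

Lemma leibniz : is_lim_seq (sum_n (fun j => (-1) ^ j / (2 * INR j + 1))) (PI / 4).
Proof.
  pose proof Alt_PI_eq as E. unfold Alt_PI in E. destruct exist_PI as [a Ha].
  replace (PI / 4) with a by lra.
  apply is_lim_seq_Reals. intros eps He. destruct (Ha eps He) as [N HN].
  exists N. intros n Hn. rewrite sum_n_Reals. specialize (HN n Hn).
  erewrite sum_eq; [exact HN|]. intros i _. unfold tg_alt, PI_tg.
  rewrite plus_INR, mult_INR. reflexivity.
Qed.

Lemma sin_between s c : 0 < s < PI -> Rmin s (PI / 2) <= c <= Rmax s (PI / 2) ->
  sin s <= sin c.
Proof.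
  intros Hs Hc. destruct (Rle_lt_dec s (PI / 2)) as [H|H].
  - rewrite Rmin_left, Rmax_right in Hc by lra. apply sin_incr_1; lra.
  - rewrite Rmin_right, Rmax_left in Hc by lra. apply sin_decr_1; lra.
Qed.

(** A Riemann-Lebesgue argument: the derivative of
    [E n t - sin (M t + th) / (2 M sin t)], with [M = 2 (n + 1)], is of order [1 / M]
    between [s] and [PI / 2], so by the mean value theorem [E n] varies there by [O (1 / M)]. *)
Lemma oscillating_primitive s th (E : nat -> R -> R) :
  0 < s < PI ->
  (forall n t, 0 < t < PI ->
     is_derive (E n) t (cos (2 * INR (S n) * t + th) / (2 * sin t))) ->
  is_lim_seq (fun n => E n (PI / 2)) 0 ->
  is_lim_seq (fun n => E n s) 0.
Proof.
  intros Hs HE H0. pose proof PI_RGT_0 as Hpi.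
  assert (Hsin : 0 < sin s) by (apply sin_gt_0; lra).
  set (K := / sin s ^ 2 * PI + / sin s + 1).
  apply is_lim_seq_abs_0.
  apply (is_lim_seq_le_le (fun _ => 0) _ (fun n => Rabs (E n (PI / 2)) + K * / INR (S n))).
  2: apply is_lim_seq_const.
  2:{ replace (Finite 0) with (Finite (0 + K * 0)) by (f_equal; ring).
      apply is_lim_seq_plus'; [now apply is_lim_seq_abs_0 in H0|].
      apply (is_lim_seq_scal_l _ K (Finite 0)).
      apply (is_lim_seq_incr_1 (fun n => / INR n)).
      apply (is_lim_seq_inv INR p_infty); [apply is_lim_seq_INR | easy]. }
  intros n. split; [apply Rabs_pos|].
  set (M := 2 * INR (S n)) in *.
  assert (HM : 0 < INR (S n)) by (apply lt_0_INR; lia).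
  set (H := fun t => E n t - sin (M * t + th) / (2 * M * sin t)).
  assert (HH : forall c, 0 < c < PI ->
     is_derive H c (sin (M * c + th) * cos c / (2 * M * sin c ^ 2))).
  { intros c Hc. assert (0 < sin c) by (apply sin_gt_0; lra).
    replace (sin (M * c + th) * cos c / (2 * M * sin c ^ 2)) with
      (cos (M * c + th) / (2 * sin c) -
        (M * cos (M * c + th) * (2 * M * sin c) - sin (M * c + th) * (2 * M * cos c))
         / (2 * M * sin c) ^ 2) by (field; unfold M; lra).
    apply (is_derive_minus (E n) (fun t => sin (M * t + th) / (2 * M * sin t))).
    - now apply HE.
    - auto_derive.
      + apply Rgt_not_eq. unfold M. repeat apply Rmult_lt_0_compat; lra.
      + field. unfold M. lra. }
  assert (Hb : forall c, Rmin s (PI / 2) <= c <= Rmax s (PI / 2) -> 0 < c < PI).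
  { intros c [H1 H2]. split.
    - apply Rlt_le_trans with (2 := H1). apply Rmin_glb_lt; lra.
    - apply Rle_lt_trans with (1 := H2). apply Rmax_lub_lt; lra. }
  destruct (MVT_gen H s (PI / 2) (fun c => sin (M * c + th) * cos c / (2 * M * sin c ^ 2)))
    as (c & Hc & Ec).
  { intros c Hc. apply HH, Hb. lra. }
  { intros c Hc. apply derivable_continuous_pt. eexists.
    apply is_derive_Reals, HH, Hb, Hc. }
  assert (Hcs := sin_between s c Hs Hc).
  assert (B1 : forall u m t, Rabs u <= 1 -> 0 < m <= t ->
                Rabs (u / (2 * M * t)) <= / m * / INR (S n)).
  { intros u m t Hu Ht. unfold Rdiv. rewrite Rabs_mult.
    assert (0 < 2 * M * t) by (unfold M; nra).
    assert (0 < / (2 * M * t)) by (apply Rinv_0_lt_compat; lra).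
    assert (/ (2 * M * t) <= / m * / INR (S n)).
    { rewrite <- Rinv_mult. apply Rinv_le_contravar; unfold M; nra. }
    rewrite (Rabs_pos_eq (/ _)) by lra. nra. }
  assert (S1 : forall t, Rabs (sin t) <= 1)
    by (intros t; apply Rabs_le; pose proof (SIN_bound t); lra).
  assert (C1 : forall t, Rabs (cos t) <= 1)
    by (intros t; apply Rabs_le; pose proof (COS_bound t); lra).
  pose proof (B1 (sin (M * s + th)) (sin s) (sin s) (S1 _) ltac:(lra)) as Q1.
  pose proof (B1 (sin (M * (PI / 2) + th)) 1 (sin (PI / 2)) (S1 _)
                ltac:(rewrite sin_PI2; lra)) as Q2.
  assert (Q3 : Rabs (sin (M * c + th) * cos c / (2 * M * sin c ^ 2))
               <= / sin s ^ 2 * / INR (S n)).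
  { apply B1; [|split; nra]. rewrite Rabs_mult. specialize (S1 (M * c + th)).
    specialize (C1 c). pose proof (Rabs_pos (sin (M * c + th))).
    pose proof (Rabs_pos (cos c)). nra. }
  assert (Q4 : Rabs (sin (M * c + th) * cos c / (2 * M * sin c ^ 2) * (PI / 2 - s))
               <= / sin s ^ 2 * PI * / INR (S n)).
  { rewrite Rabs_mult. assert (Rabs (PI / 2 - s) <= PI) by (apply Rabs_le; lra).
    pose proof (Rabs_pos (PI / 2 - s)).
    replace (/ sin s ^ 2 * PI * / INR (S n)) with (/ sin s ^ 2 * / INR (S n) * PI) by ring.
    apply Rmult_le_compat; try assumption; apply Rabs_pos. }
  replace (E n s) with (E n (PI / 2)
    + (- (sin (M * (PI / 2) + th) / (2 * M * sin (PI / 2)))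
    + (sin (M * s + th) / (2 * M * sin s)
    + - (sin (M * c + th) * cos c / (2 * M * sin c ^ 2) * (PI / 2 - s))))).
  2:{ rewrite <- Ec. unfold H. ring. }
  unfold K. rewrite Rinv_1 in Q2.
  eapply Rle_trans; [apply Rabs_triang|]. apply Rplus_le_compat_l.
  eapply Rle_trans; [apply Rabs_triang|]. rewrite Rabs_Ropp.
  eapply Rle_trans; [apply Rplus_le_compat_l, Rabs_triang|]. rewrite Rabs_Ropp. lra.
Qed.

Definition odd_harmonics (th : R) (N : nat) (s : R) : R :=
  sum_n (fun j => cos ((2 * INR j + 1) * s + th) / (2 * INR j + 1)) N.

Lemma two_j_plus_1_pos j : 0 < 2 * INR j + 1.
Proof. pose proof (pos_INR j). lra. Qed.

(** The differentiated sum is geometric, hence telescopes after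
    multiplication by [2 sin s]. *)
Lemma is_derive_odd_harmonics th N s : 0 < s < PI ->
  is_derive (odd_harmonics th N) s
    ((cos (2 * INR (S N) * s + th) - cos th) / (2 * sin s)).
Proof.
  intros Hs. assert (0 < sin s) by (apply sin_gt_0; lra).
  assert (D : forall j, is_derive (fun s => cos ((2 * INR j + 1) * s + th) / (2 * INR j + 1))
                s (- sin ((2 * INR j + 1) * s + th))).
  { intros j. pose proof (two_j_plus_1_pos j). auto_derive; [easy|]. field. lra. }
  assert (X : forall a, cos (a + s) - cos (a - s) = - 2 * sin a * sin s)
    by (intros a; rewrite cos_plus, cos_minus; ring).
  unfold odd_harmonics. induction N as [|N IH].
  - apply (is_derive_ext (fun s => cos ((2 * INR 0 + 1) * s + th) / (2 * INR 0 + 1))).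
    { intros t. now rewrite sum_O. }
    replace ((cos (2 * INR 1 * s + th) - cos th) / (2 * sin s))
      with (- sin ((2 * INR 0 + 1) * s + th)); [apply D|].
    simpl INR. specialize (X (s + th)).
    replace (2 * 1 * s + th) with (s + th + s) by ring.
    replace th with (s + th - s) at 3 by ring. rewrite X.
    replace ((2 * 0 + 1) * s + th) with (s + th) by ring. field. lra.
  - apply (is_derive_ext (fun s => sum_n (fun j => cos ((2 * INR j + 1) * s + th)
                             / (2 * INR j + 1)) N
             + cos ((2 * INR (S N) + 1) * s + th) / (2 * INR (S N) + 1))).
    { intros t. now rewrite sum_Sn. }
    replace ((cos (2 * INR (S (S N)) * s + th) - cos th) / (2 * sin s))
      with ((cos (2 * INR (S N) * s + th) - cos th) / (2 * sin s)
            + - sin ((2 * INR (S N) + 1) * s + th)).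
    { apply (is_derive_plus (K := R_AbsRing) (V := R_NormedModule)); [exact IH | apply D]. }
    specialize (X ((2 * INR (S N) + 1) * s + th)). rewrite !(S_INR (S N)).
    replace (2 * (INR (S N) + 1) * s + th)
      with ((2 * INR (S N) + 1) * s + th + s) by ring.
    replace (2 * INR (S N) * s + th) with ((2 * INR (S N) + 1) * s + th - s) by ring.
    replace (cos ((2 * INR (S N) + 1) * s + th + s)) with
      (cos ((2 * INR (S N) + 1) * s + th - s)
        - 2 * sin ((2 * INR (S N) + 1) * s + th) * sin s) by lra.
    field. lra.
Qed.

Lemma odd_harmonics_PI2 th N :
  odd_harmonics th N (PI / 2)
  = - sin th * sum_n (fun j => (-1) ^ j / (2 * INR j + 1)) N.
Proof.
  unfold odd_harmonics. rewrite <- (sum_n_mult_l (K := R_AbsRing)).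
  apply sum_n_ext. intros j. unfold mult; simpl.
  assert (E : cos ((2 * INR j + 1) * (PI / 2) + th) = - sin th * (-1) ^ j).
  { induction j as [|j IH].
    - simpl INR. replace ((2 * 0 + 1) * (PI / 2) + th) with (PI / 2 + th) by field.
      rewrite cos_plus, cos_PI2, sin_PI2. simpl. ring.
    - rewrite S_INR.
      replace ((2 * (INR j + 1) + 1) * (PI / 2) + th)
        with ((2 * INR j + 1) * (PI / 2) + th + PI) by field.
      rewrite neg_cos, IH. simpl. ring. }
  rewrite E. unfold Rdiv. ring.
Qed.

(** For [th = 0] and [th = - PI / 2] these are the real and imaginary parts of
    the sum of [exp (i m s) / m] over odd [m > 0]. *)
Lemma lim_odd_harmonics th s : 0 < s < PI ->
  is_lim_seq (fun N => odd_harmonics th N s) (/ 2 * lcot s * cos th - PI / 4 * sin th).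
Proof.
  intros Hs.
  pose (E := fun (N : nat) t => odd_harmonics th N t + (PI / 4 * sin th - / 2 * cos th * lcot t)).
  assert (H : is_lim_seq (fun N => E N s) 0).
  { apply (oscillating_primitive s th E Hs).
    - intros n t Ht. unfold E.
      pose proof (one_plus_cos_pos t ltac:(lra)) as H1. pose proof (one_minus_cos_pos t ltac:(lra)) as H2.
      assert (0 < sin t) by (apply sin_gt_0; lra).
      replace (cos (2 * INR (S n) * t + th) / (2 * sin t))
        with ((cos (2 * INR (S n) * t + th) - cos th) / (2 * sin t)
              + (0 - / 2 * cos th * - (sin t / sin t ^ 2))) by (field; lra).
      apply (is_derive_plus (K := R_AbsRing) (V := R_NormedModule)).
      + now apply is_derive_odd_harmonics.
      + apply (is_derive_minus (K := R_AbsRing) (V := R_NormedModule));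
          [apply (is_derive_const (K := R_AbsRing) (V := R_NormedModule))|].
        apply is_derive_scal. now apply is_derive_lcot.
    - unfold E.
      assert (Hl : lcot (PI / 2) = 0).
      { unfold lcot. rewrite cos_PI2. replace ((1 + 0) / (1 - 0)) with 1 by field.
        rewrite ln_1. ring. }
      rewrite Hl.
      replace (Finite 0) with (Finite (- sin th * (PI / 4) + PI / 4 * sin th)) by (f_equal; ring).
      apply is_lim_seq_plus'.
      + apply (is_lim_seq_ext (fun N => - sin th * sum_n (fun j => (-1) ^ j / (2 * INR j + 1)) N)).
        { intros N. now rewrite odd_harmonics_PI2. }
        apply (is_lim_seq_scal_l _ (- sin th) (Finite (PI / 4))). exact leibniz.
      + replace (PI / 4 * sin th - / 2 * cos th * 0) with (PI / 4 * sin th) by ring.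
        apply is_lim_seq_const. }
  apply (is_lim_seq_ext (fun N => E N s
    + (/ 2 * lcot s * cos th - PI / 4 * sin th))).
  { intros N. unfold E. ring. }
  replace (Finite (/ 2 * lcot s * cos th - PI / 4 * sin th))
    with (Finite (0 + (/ 2 * lcot s * cos th - PI / 4 * sin th))) by (f_equal; ring).
  apply is_lim_seq_plus'; [exact H | apply is_lim_seq_const].
Qed.

(** With [m = 2 j + 1] this is [(m - 2) m (m + 2)]. *)
Definition cubic (j : nat) : R := (2 * INR j - 1) * (2 * INR j + 1) * (2 * INR j + 3).

Lemma cubic_neq_0 j : 2 * INR j - 1 <> 0 /\ 2 * INR j + 1 <> 0 /\ 2 * INR j + 3 <> 0.
Proof.
  pose proof (pos_INR j). repeat split; try lra.
  destruct j as [|j]; [simpl; lra|]. rewrite S_INR in *. pose proof (pos_INR j). lra.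
Qed.

(** Summation by parts: [8 / cubic j] is the second difference of [1 / (2 j + 1)], and the
    second difference of [cos ((2 j + 1) s + th)] is [- 4 sin^2 s] times itself. *)
Lemma sum_cubic th s N :
  8 * sum_n (fun j => cos ((2 * INR j + 1) * s + th) / cubic j) N
  = - 4 * sin s ^ 2 * odd_harmonics th N s - 2 * cos s * cos th
    - cos ((2 * INR N + 3) * s + th) / (2 * INR N + 1)
    + cos ((2 * INR N + 1) * s + th) / (2 * INR N + 3).
Proof.
  unfold odd_harmonics, cubic.
  assert (X : forall a, cos (a + 2 * s) = (2 - 4 * sin s ^ 2) * cos a - cos (a - 2 * s)).
  { intros a. pose proof (f_equal fst (cis_second_diff a s)) as E. simpl in E. simpl. lra. }
  induction N as [|N IH].
  - rewrite !sum_O. simpl INR.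
    replace ((2 * 0 + 3) * s + th) with ((s + th) + 2 * s) by ring.
    replace ((2 * 0 + 1) * s + th) with (s + th) by ring. rewrite X.
    replace (s + th - 2 * s) with (th - s) by ring.
    rewrite !cos_plus, cos_minus. field.
  - rewrite !sum_Sn. change (@plus R_AbelianMonoid) with Rplus. rewrite (Rmult_plus_distr_l 8), IH.
    destruct (cubic_neq_0 (S N)) as (H1 & H2 & H3). rewrite !S_INR in *.
    replace ((2 * (INR N + 1) + 3) * s + th)
      with ((2 * INR N + 3) * s + th + 2 * s) by ring.
    rewrite X.
    replace ((2 * INR N + 3) * s + th - 2 * s) with ((2 * INR N + 1) * s + th) by ring.
    replace ((2 * (INR N + 1) + 1) * s + th) with ((2 * INR N + 3) * s + th) by ring.
    pose proof (pos_INR N). field. repeat split; lra.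
Qed.

Lemma is_series_cubic th s : 0 < s < PI ->
  is_series (fun j => cos ((2 * INR j + 1) * s + th) / cubic j)
    (/ 8 * (- 2 * sin s ^ 2 * (lcot s * cos th - PI / 2 * sin th) - 2 * cos s * cos th)).
Proof.
  intros Hs.
  assert (V : forall (c : R) (a : nat -> R), 0 < c ->
     is_lim_seq (fun N => cos (a N) / (2 * INR N + c)) 0).
  { intros c a Hc. apply is_lim_seq_abs_0.
    apply (is_lim_seq_le_le_loc (fun _ => 0) _ (fun N => / INR N)).
    - exists 1%nat. intros n Hn. split; [apply Rabs_pos|].
      assert (0 < INR n) by (apply lt_0_INR; lia). unfold Rdiv. rewrite Rabs_mult.
      assert (0 < / (2 * INR n + c)) by (apply Rinv_0_lt_compat; lra).
      rewrite (Rabs_pos_eq (/ _)) by lra.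
      assert (/ (2 * INR n + c) <= / INR n) by (apply Rinv_le_contravar; lra).
      assert (Rabs (cos (a n)) <= 1) by (apply Rabs_le; pose proof (COS_bound (a n)); lra).
      pose proof (Rabs_pos (cos (a n))). nra.
    - apply is_lim_seq_const.
    - apply (is_lim_seq_inv INR p_infty); [apply is_lim_seq_INR | easy]. }
  change (is_lim_seq (sum_n (fun j => cos ((2 * INR j + 1) * s + th) / cubic j))
    (/ 8 * (- 2 * sin s ^ 2 * (lcot s * cos th - PI / 2 * sin th) - 2 * cos s * cos th))).
  apply (is_lim_seq_ext (fun N => / 8 * ((- 4 * sin s ^ 2 * odd_harmonics th N s
    + - 2 * cos s * cos th)
    + (cos ((2 * INR N + 1) * s + th) / (2 * INR N + 3)
    - cos ((2 * INR N + 3) * s + th) / (2 * INR N + 1))))).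
  { intros N. apply (Rmult_eq_reg_l 8); [|lra]. rewrite sum_cubic.
    destruct (cubic_neq_0 N) as (_ & H1 & H3). field. split; assumption. }
  apply (is_lim_seq_scal_l _ (/ 8) (Finite _)).
  replace (Finite (- 2 * sin s ^ 2 * (lcot s * cos th - PI / 2 * sin th) - 2 * cos s * cos th))
    with (Finite ((- 4 * sin s ^ 2 * (/ 2 * lcot s * cos th - PI / 4 * sin th)
       + - 2 * cos s * cos th) + (0 - 0))) by (f_equal; field).
  apply is_lim_seq_plus'; [apply is_lim_seq_plus'|].
  - apply (is_lim_seq_scal_l _ _ (Finite _)). now apply lim_odd_harmonics.
  - apply is_lim_seq_const.
  - apply is_lim_seq_minus'; apply V; lra.
Qed.

(** * The hypergeometric value *)

Lemma sum_n_C (a : nat -> C) N :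
  sum_n (G := C_R_NormedModule) a N
  = (sum_n (fun n => Re (a n)) N, sum_n (fun n => Im (a n)) N).
Proof.
  induction N as [|N IH].
  - rewrite !sum_O. now destruct (a 0%nat).
  - now rewrite !sum_Sn, IH.
Qed.

Lemma is_series_C (a : nat -> C) (l : C) :
  is_series (K := R_AbsRing) (V := C_R_NormedModule) a l <->
  is_series (fun n => Re (a n)) (Re l) /\ is_series (fun n => Im (a n)) (Im l).
Proof.
  split.
  - intros H; split; apply filterlim_locally; intros e;
      destruct (H _ (locally_ball (T := C_R_NormedModule) l e)) as [M HM];
      exists M; intros N HN; specialize (HM N HN); rewrite sum_n_C in HM; apply HM.
  - intros [H1 H2]. apply filterlim_locally. intros e.
    destruct (H1 _ (locally_ball (Re l) e)) as [N1 HN1].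
    destruct (H2 _ (locally_ball (Im l) e)) as [N2 HN2].
    exists (max N1 N2). intros N HN. rewrite sum_n_C.
    split; [apply HN1 | apply HN2]; lia.
Qed.

Lemma is_series_C_mult (c : C) (a : nat -> C) (l : C) :
  is_series (K := R_AbsRing) (V := C_R_NormedModule) a l ->
  is_series (K := R_AbsRing) (V := C_R_NormedModule) (fun n => c * a n)%C (c * l)%C.
Proof.
  intros H. apply is_series_C in H as [H1 H2].
  apply is_series_C; simpl; split.
  - apply (is_series_minus (K := R_AbsRing) (V := R_NormedModule));
      now apply (is_series_scal (K := R_AbsRing) (V := R_NormedModule)).
  - apply (is_series_plus (K := R_AbsRing) (V := R_NormedModule));
      now apply (is_series_scal (K := R_AbsRing) (V := R_NormedModule)).
Qed.

(** The terms of the sum of [exp (i m s) / ((m - 2) m (m + 2))] over odd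
    [m >= - k], indexed by [m = 2 n - k]. *)
Definition tail_term (s : R) (k : Z) (n : nat) : C :=
  (cis ((2 * INR n - IZR k) * s)
   / RtoC ((2 * INR n - 2 - IZR k) * (2 * INR n - IZR k) * (2 * INR n + 2 - IZR k)))%C.

(** Solves [V k = - i (PI / 2) sin^2 s + exp (- i k s) / (k (k + 2)) - 4 T] for [T], which
    is the way the hypergeometric formula expresses [V k]. *)
Definition tail_sum (s : R) (V : Z -> C) (k : Z) : C :=
  (- (V k + Ci * RtoC (PI / 2 * sin s ^ 2)
      - cis (- IZR k * s) / RtoC (IZR k * IZR (k + 2))) / 4)%C.

Lemma tail_term_shift s k n : tail_term s (k + 2) (S n) = tail_term s k n.
Proof.
  unfold tail_term. rewrite S_INR, plus_IZR.
  f_equal; [f_equal; ring | do 2 f_equal; ring].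
Qed.

Lemma tail_sum_shift s V k : recurrence s V -> Z.Odd k ->
  tail_sum s V (k + 2) = (tail_sum s V k + tail_term s (k + 2) 0)%C.
Proof.
  intros [_ HV] Hk. unfold tail_sum, tail_term. rewrite (HV k Hk).
  assert (Hp : Z.Odd (k + 2)) by (destruct Hk as [m ->]; exists (m + 1)%Z; lia).
  assert (Hq : Z.Odd (k + 4)) by (destruct Hk as [m ->]; exists (m + 2)%Z; lia).
  apply IZR_odd_neq_0 in Hk. apply IZR_odd_neq_0 in Hp. apply IZR_odd_neq_0 in Hq.
  simpl INR. replace ((2 * 0 - IZR (k + 2)) * s) with (- IZR (k + 2) * s) by ring.
  generalize (cis (- IZR (k + 2) * s)), (cis (- IZR k * s)), (V k).
  replace (k + 2 + 2)%Z with (k + 4)%Z by ring.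
  rewrite !plus_IZR in *. intros a b v.
  rewrite !Cdiv_RtoC.
  apply injective_projections; simpl; field; repeat split;
    try assumption; intros E; lra.
Qed.

(** Moving [k] by 2 adds or removes one term, so convergence and the value
    spread from [k = -1] to all odd [k] in both directions. *)
Lemma is_series_tail s V k : 0 < s < PI -> recurrence s V -> Z.Odd k ->
  is_series (K := R_AbsRing) (V := C_R_NormedModule) (tail_term s k) (tail_sum s V k).
Proof.
  intros Hs HV [m ->].
  assert (Step : forall k, Z.Odd k ->
    is_series (K := R_AbsRing) (V := C_R_NormedModule) (tail_term s k) (tail_sum s V k) <->
    is_series (K := R_AbsRing) (V := C_R_NormedModule)
      (tail_term s (k + 2)) (tail_sum s V (k + 2))).
  { intros k Hk. split; intros H.
    - apply is_series_decr_1.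
      apply (is_series_ext (tail_term s k)); [intros n; now rewrite tail_term_shift|].
      rewrite (tail_sum_shift s V k HV Hk).
      refine (eq_ind _ (is_series _) H _ _).
      apply injective_projections; unfold plus, opp; simpl; unfold plus, opp; simpl; ring.
    - apply (is_series_ext (fun n => tail_term s (k + 2) (S n)));
        [intros n; now rewrite tail_term_shift|].
      apply is_series_incr_1.
      now rewrite (tail_sum_shift s V k HV Hk) in H. }
  induction m as [|m IH|m IH] using Z.peano_ind.
  - apply (Step (-1)%Z); [now exists (-1)%Z|].
    destruct HV as [HV _]. unfold tail_sum. rewrite HV.
    apply is_series_C; split.
    (* The phases [0] and [- PI / 2] give the real and the imaginary part. *)
    + pose proof (is_series_cubic 0 s Hs) as H. rewrite cos_0, sin_0 in H.
      refine (eq_ind _ _ (is_series_ext _ _ _ _ H) _ _).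
      * intros n. unfold tail_term, cubic. rewrite Cdiv_RtoC. simpl. rewrite Rplus_0_r.
        replace (2 * INR n - -1) with (2 * INR n + 1) by ring.
        f_equal. ring.
      * unfold cis. replace (- -1 * s) with s by ring. simpl. field.
    + pose proof (is_series_cubic (- (PI / 2)) s Hs) as H.
      rewrite cos_neg, sin_neg, cos_PI2, sin_PI2 in H.
      refine (eq_ind _ _ (is_series_ext _ _ _ _ H) _ _).
      * intros n. unfold tail_term, cubic. rewrite Cdiv_RtoC. simpl.
        rewrite cos_plus, cos_neg, sin_neg, cos_PI2, sin_PI2.
        replace (2 * INR n - -1) with (2 * INR n + 1) by ring.
        unfold Rdiv. f_equal; [ring|]. f_equal. ring.
      * unfold cis. replace (- -1 * s) with s by ring. simpl. field.
  - replace (2 * Z.succ m + 1)%Z with (2 * m + 1 + 2)%Z by lia.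
    exact (proj1 (Step _ (ex_intro _ m eq_refl)) IH).
  - apply (proj2 (Step _ (ex_intro _ (Z.pred m) eq_refl))).
    now replace (2 * Z.pred m + 1 + 2)%Z with (2 * m + 1)%Z by lia.
Qed.

Lemma Cpow_cis t n : Cpow (cis t) n = cis (INR n * t).
Proof.
  induction n as [|n IH].
  - simpl. unfold cis. now rewrite Rmult_0_l, cos_0, sin_0.
  - rewrite S_INR. change (Cpow (cis t) (S n)) with (cis t * Cpow (cis t) n)%C.
    rewrite IH, <- cis_plus. f_equal. ring.
Qed.

Lemma Cpoch_1 n : Cpoch 1 n = RtoC (INR (fact n)).
Proof.
  induction n as [|n IH]; [reflexivity|].
  simpl Cpoch. rewrite IH. change (fact (S n)) with (S n * fact n)%nat.
  rewrite mult_INR, S_INR, !RtoC_mult, RtoC_plus. ring.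
Qed.

(** Telescoping of [(b)_n / (b + 3)_n], cleared of denominators. *)
Lemma Cpoch_shift3 (b : R) n :
  (Cpoch (RtoC b) n * RtoC ((b + INR n) * (b + INR n + 1) * (b + INR n + 2)))%C
  = (RtoC (b * (b + 1) * (b + 2)) * Cpoch (RtoC (b + 3)) n)%C.
Proof.
  induction n as [|n IH].
  - simpl. rewrite <- !RtoC_mult. f_equal. ring.
  - simpl Cpoch. rewrite S_INR.
    transitivity (Cpoch b n * RtoC ((b + INR n) * (b + INR n + 1) * (b + INR n + 2))
                  * RtoC (b + 3 + INR n))%C.
    + rewrite <- !RtoC_plus, <- !Cmult_assoc, <- !RtoC_mult. do 2 f_equal. ring.
    + rewrite IH, (RtoC_plus (b + 3)). ring.
Qed.

Lemma Cpoch_neq_0 (c : R) n : (forall j, c + INR j <> 0) -> Cpoch (RtoC c) n <> 0%C.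
Proof.
  intros Hc. induction n as [|n IH]; simpl.
  - apply RtoC_neq_0, R1_neq_R0.
  - apply Cmult_neq_0; [exact IH|]. rewrite <- RtoC_plus. now apply RtoC_neq_0.
Qed.

Lemma half_odd_neq_0 k j : Z.Odd k -> 2 * IZR j - IZR k <> 0.
Proof.
  intros [m ->]. rewrite <- mult_IZR, <- minus_IZR. apply not_0_IZR. lia.
Qed.

(** Sums and series in normed modules leave equations typed by the carrier of the
    structure, on which [ring] and [field] do not act until it is read as [C]. *)
Ltac as_C_eq := match goal with |- ?l = ?r => change (@eq C l r) end.

(** The first parameter [1] cancels the factorials and the other two differ by
    [3], so the coefficients are reciprocals of the cubic in [tail_term]. *)
Lemma hyp2F1_tail s V k : 0 < s < PI -> recurrence s V -> Z.Odd k ->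
  hyp2F1 1 (- 1 - IZR k / 2)%C (2 - IZR k / 2)%C (cis (2 * s))
  = (RtoC (IZR k * (4 - IZR k ^ 2)) * cis (IZR k * s) * tail_sum s V k)%C.
Proof.
  intros Hs HV Hk. apply is_series_CSeries.
  refine (is_series_ext _ _ _ _ (is_series_C_mult _ _ _ (is_series_tail s V k Hs HV Hk))).
  intros n.
  replace (- 1 - IZR k / 2)%C with (RtoC (- 1 - IZR k / 2))
    by (apply injective_projections; simpl; field).
  replace (2 - IZR k / 2)%C with (RtoC (- 1 - IZR k / 2 + 3))
    by (apply injective_projections; simpl; field).
  assert (Hc : forall j, - 1 - IZR k / 2 + 3 + INR j <> 0).
  { intros j E. apply (half_odd_neq_0 k (Z.of_nat j + 2) Hk).
    rewrite plus_IZR, <- INR_IZR_INZ. lra. }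
  assert (H1 : 2 * INR n - 2 - IZR k <> 0).
  { intros E. apply (half_odd_neq_0 k (Z.of_nat n - 1) Hk).
    rewrite minus_IZR, <- INR_IZR_INZ. lra. }
  assert (H2 : 2 * INR n - IZR k <> 0).
  { intros E. apply (half_odd_neq_0 k (Z.of_nat n) Hk).
    rewrite <- INR_IZR_INZ. lra. }
  assert (H3 : 2 * INR n + 2 - IZR k <> 0).
  { intros E. apply (half_odd_neq_0 k (Z.of_nat n + 1) Hk).
    rewrite plus_IZR, <- INR_IZR_INZ. lra. }
  pose proof (Cpoch_neq_0 _ n Hc) as H4.
  pose proof (Cpoch_shift3 (- 1 - IZR k / 2) n) as E.
  set (b := - 1 - IZR k / 2) in *.
  assert (E1 : (b + INR n) * (b + INR n + 1) * (b + INR n + 2)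
    = / 8 * ((2 * INR n - 2 - IZR k) * (2 * INR n - IZR k) * (2 * INR n + 2 - IZR k)))
    by (unfold b; field).
  assert (E2 : b * (b + 1) * (b + 2) = / 8 * (IZR k * (4 - IZR k ^ 2))) by (unfold b; field).
  rewrite E1, E2, (RtoC_mult (/ 8)), (RtoC_mult (/ 8)) in E.
  rewrite Cpow_cis, Cpoch_1. unfold tail_term.
  replace (INR n * (2 * s)) with (IZR k * s + (2 * INR n - IZR k) * s) by ring.
  rewrite cis_plus.
  assert (HD : RtoC ((2 * INR n - 2 - IZR k) * (2 * INR n - IZR k) * (2 * INR n + 2 - IZR k)) <> 0%C)
    by (apply RtoC_neq_0; repeat apply Rmult_integral_contrapositive_currified; assumption).
  assert (HF : RtoC (INR (fact n)) <> 0%C) by apply RtoC_neq_0, INR_fact_neq_0.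
  assert (HC : RtoC (/ 8) <> 0%C) by (apply RtoC_neq_0; lra).
  revert E HD HF HC H4.
  generalize (RtoC (/ 8)), (Cpoch (RtoC (b + 3)%R) n), (Cpoch (RtoC b) n), (RtoC (INR (fact n))),
   (cis (IZR k * s)), (cis ((2 * INR n - IZR k) * s)), (RtoC (IZR k * (4 - IZR k ^ 2))),
   (RtoC ((2 * INR n - 2 - IZR k) * (2 * INR n - IZR k) * (2 * INR n + 2 - IZR k))).
  intros c q p f u v w d E HD HF HC H4.
  assert (E3 : p = (w * q / d)%C).
  { transitivity (p * (c * d) / (c * d))%C; [|rewrite E]; field; auto. }
  rewrite E3. as_C_eq. field. auto.
Qed.

(** * The finite-sum solution of the recurrence *)

Definition sum_term (e s : R) (n : nat) : C :=
  (4 * cis (- e * (2 * INR n + 1) * s) / RtoC (cubic n))%C.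

(** The finite-sum solution at [k = e (2 n + 1)] for a sign [e]; the last term is
    what [2 i sgn(k) / (PI (2 + |k|))] becomes when the factor
    [2 i k exp (i k s) / PI] is taken out. *)
Definition signed_form (e s : R) (n : nat) : C :=
  (RtoC (cos s + sin s ^ 2 * lcot s) + sum_n (sum_term e s) n
   + cis (- e * (2 * INR n + 1) * s) / RtoC ((2 * INR n + 1) * (2 * INR n + 3)))%C.

Lemma signed_form_S e s n :
  signed_form e s (S n) = (signed_form e s n
    + (cis (- e * (2 * INR n + 3) * s) - cis (- e * (2 * INR n + 1) * s))
      / RtoC ((2 * INR n + 1) * (2 * INR n + 3)))%C.
Proof.
  unfold signed_form. rewrite sum_Sn. unfold sum_term at 2, cubic.
  generalize (sum_n (sum_term e s) n). intros z.
  rewrite S_INR. replace (2 * (INR n + 1) + 1) with (2 * INR n + 3) by ring.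
  replace (2 * (INR n + 1) - 1) with (2 * INR n + 1) by ring.
  pose proof (pos_INR n). rewrite !Cdiv_RtoC.
  change (@plus C_AbelianMonoid) with Cplus.
  apply injective_projections; simpl; field; repeat split; lra.
Qed.

Definition closed_form (s : R) (k : Z) : C :=
  signed_form (IZR (Z.sgn k)) s (Z.to_nat ((Z.abs k - 1) / 2)).

Lemma closed_form_pos s n : closed_form s (2 * Z.of_nat n + 1) = signed_form 1 s n.
Proof.
  unfold closed_form. replace (Z.sgn _) with 1%Z by lia.
  f_equal. replace (Z.abs _ - 1)%Z with (Z.of_nat n * 2)%Z by lia.
  rewrite Z.div_mul by easy. apply Nat2Z.id.
Qed.

Lemma closed_form_neg s n : closed_form s (- (2 * Z.of_nat n + 1)) = signed_form (-1) s n.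
Proof.
  unfold closed_form. replace (Z.sgn _) with (-1)%Z by lia.
  f_equal. replace (Z.abs _ - 1)%Z with (Z.of_nat n * 2)%Z by lia.
  rewrite Z.div_mul by easy. apply Nat2Z.id.
Qed.

Lemma signed_form_0 e s :
  signed_form e s 0 = (RtoC (cos s + sin s ^ 2 * lcot s) - cis (- e * s))%C.
Proof.
  unfold signed_form. rewrite sum_O. unfold sum_term, cubic. simpl INR.
  replace (- e * (2 * 0 + 1) * s) with (- e * s) by ring.
  rewrite !Cdiv_RtoC. apply injective_projections; simpl; field.
Qed.

(** On each sign of [k] the step is [signed_form_S]; the step from [-1] to [1] is
    where the two signs have to agree. *)
Lemma recurrence_closed_form s : recurrence s (closed_form s).
Proof.
  split.
  - change (-1)%Z with (- (2 * Z.of_nat 0 + 1))%Z. rewrite closed_form_neg, signed_form_0.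
    unfold cis. replace (- -1 * s) with s by ring.
    apply injective_projections; simpl; ring.
  - intros k [m ->]. destruct (Z.le_gt_cases 0 m) as [Hm|Hm].
    + rewrite <- (Z2Nat.id m Hm). set (n := Z.to_nat m).
      replace (2 * Z.of_nat n + 1 + 2)%Z with (2 * Z.of_nat (S n) + 1)%Z by lia.
      rewrite !closed_form_pos, signed_form_S, !plus_IZR, !mult_IZR, <- !INR_IZR_INZ, S_INR.
      f_equal. f_equal; [|f_equal; ring]. f_equal; [|f_equal]; f_equal; ring.
    + destruct (Z.eq_dec m (-1)) as [->|Hm'].
      * change (2 * -1 + 1 + 2)%Z with (2 * Z.of_nat 0 + 1)%Z.
        change (2 * -1 + 1)%Z with (- (2 * Z.of_nat 0 + 1))%Z at 1.
        rewrite closed_form_pos, closed_form_neg, !signed_form_0.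
        change (2 * Z.of_nat 0 + 1)%Z with 1%Z. change (2 * -1 + 1)%Z with (-1)%Z.
        unfold cis. replace (- -1 * s) with s by ring.
        rewrite Cdiv_RtoC. apply injective_projections; simpl; field.
      * replace m with (- Z.of_nat (S (Z.to_nat (- m - 2))) - 1)%Z by lia.
        set (n := Z.to_nat (- m - 2)).
        replace (2 * (- Z.of_nat (S n) - 1) + 1 + 2)%Z
          with (- (2 * Z.of_nat n + 1))%Z by lia.
        replace (2 * (- Z.of_nat (S n) - 1) + 1)%Z
          with (- (2 * Z.of_nat (S n) + 1))%Z by lia.
        rewrite !closed_form_neg, signed_form_S, !opp_IZR, !plus_IZR, !mult_IZR, <- !INR_IZR_INZ, S_INR.
        replace (- - (2 * INR n + 1) * s) with (- -1 * (2 * INR n + 1) * s) by ring.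
        replace (- - (2 * (INR n + 1) + 1) * s) with (- -1 * (2 * INR n + 3) * s) by ring.
        generalize (signed_form (-1) s n). intros z. pose proof (pos_INR n).
        rewrite !Cdiv_RtoC. apply injective_projections; simpl; field; lra.
Qed.

Open Scope C_scope.

(** * The two closed formulas in the angle variable *)

Lemma cis_mult_opp t : cis t * cis (- t) = 1.
Proof.
  rewrite <- cis_plus, Rplus_opp_r. unfold cis. now rewrite cos_0, sin_0.
Qed.

Lemma PI_neq_0_C : RtoC PI <> 0.
Proof. apply RtoC_neq_0, PI_neq0. Qed.

Lemma Riesz_Feller_sum gamma k x : Z.Odd k ->
  is_Riesz_Feller gamma (phi k) x
    (cos (gamma * (PI / 2))
     * (2 * Ci * IZR (Z.sgn k) / (PI * (2 + IZR (Z.abs k)))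
        + 2 * Ci * IZR k * cis (IZR k * acot x) / PI
          * (RtoC (cos (acot x) + sin (acot x) ^ 2 * lcot (acot x))
             + sum_n (sum_term (IZR (Z.sgn k)) (acot x)) (Z.to_nat ((Z.abs k - 1) / 2))))
     - sin (gamma * (PI / 2))
       * (Ci * IZR k * RtoC (sin (acot x) ^ 2) * cis (IZR k * acot x))).
Proof.
  intros Hk.
  refine (eq_ind _ _ (is_Riesz_Feller_phi gamma k x _ Hk (recurrence_closed_form (acot x))) _ _).
  f_equal. f_equal.
  assert (Hn : (2 * INR (Z.to_nat ((Z.abs k - 1) / 2)) + 1)%R = IZR (Z.abs k)).
  { assert (0 < Z.abs k)%Z by (destruct Hk; lia).
    assert (Hm : exists m, Z.abs k = (2 * m + 1)%Z).
    { destruct Hk as [m ->]. destruct (Z.le_gt_cases 0 m);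
        [exists m | exists (- m - 1)%Z]; lia. }
    destruct Hm as [m Hm]. rewrite Hm.
    replace (2 * m + 1 - 1)%Z with (m * 2)%Z by ring. rewrite Z.div_mul by easy.
    rewrite INR_IZR_INZ, Z2Nat.id by lia. rewrite plus_IZR, mult_IZR. ring. }
  unfold closed_form, signed_form.
  replace (2 * INR (Z.to_nat ((Z.abs k - 1) / 2)) + 3)%R with (2 + IZR (Z.abs k))%R
    by (rewrite <- Hn; ring).
  rewrite Hn.
  replace (- IZR (Z.sgn k) * IZR (Z.abs k))%R with (- IZR k)%R
    by (rewrite Ropp_mult_distr_l_reverse, <- mult_IZR; f_equal; f_equal; lia).
  assert (Ha : (0 < IZR (Z.abs k))%R).
  { apply (IZR_lt 0). destruct Hk; lia. }
  assert (Hs : RtoC (IZR k) = RtoC (IZR (Z.sgn k)) * RtoC (IZR (Z.abs k)))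
    by (rewrite <- RtoC_mult, <- mult_IZR; do 2 f_equal; lia).
  pose proof (cis_mult_opp (IZR k * acot x)) as Hc.
  replace (- (IZR k * acot x))%R with (- IZR k * acot x)%R in Hc by ring.
  generalize (sum_n (sum_term (IZR (Z.sgn k)) (acot x)) (Z.to_nat ((Z.abs k - 1) / 2))).
  intros z. rewrite Hs.
  transitivity (2 * Ci * (IZR (Z.sgn k) * IZR (Z.abs k))
      * (cis (IZR k * acot x) * cis (- IZR k * acot x)) / PI
      / RtoC (IZR (Z.abs k) * (2 + IZR (Z.abs k)))
    + 2 * Ci * (IZR (Z.sgn k) * IZR (Z.abs k)) * cis (IZR k * acot x) / PI *
      (RtoC (cos (acot x) + sin (acot x) ^ 2 * lcot (acot x)) + z)).
  - unfold Cdiv. ring.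
  - rewrite Hc. f_equal. rewrite RtoC_mult, RtoC_plus. field.
    repeat split; [|exact PI_neq_0_C|apply RtoC_neq_0; lra].
    rewrite <- RtoC_plus. apply RtoC_neq_0. lra.
Qed.

Lemma Riesz_Feller_hyp gamma k x : Z.Odd k ->
  is_Riesz_Feller gamma (phi k) x
    (IZR k * cis (- (gamma * (PI / 2))) * RtoC (sin (acot x) ^ 2) * cis (IZR k * acot x)
     + cos (gamma * (PI / 2))
       * (2 * Ci / (PI * (2 + IZR k))
          - 8 * Ci / (PI * (4 - IZR k ^ 2))
            * hyp2F1 1 (- 1 - IZR k / 2) (2 - IZR k / 2) (cis (2 * acot x)))).
Proof.
  intros Hk. pose proof (recurrence_closed_form (acot x)) as HV.
  refine (eq_ind _ _ (is_Riesz_Feller_phi gamma k x _ Hk HV) _ _).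
  rewrite (hyp2F1_tail _ _ k (acot_bound x) HV Hk). unfold tail_sum.
  pose proof (IZR_odd_neq_0 k Hk) as H0.
  assert (H2 : (IZR k + 2)%R <> 0%R).
  { rewrite <- plus_IZR. apply IZR_odd_neq_0. destruct Hk as [m ->]. exists (m + 1)%Z. lia. }
  assert (H3 : (IZR k - 2)%R <> 0%R).
  { rewrite <- minus_IZR. apply IZR_odd_neq_0. destruct Hk as [m ->]. exists (m - 1)%Z. lia. }
  assert (Hg : cis (- (gamma * (PI / 2)))
     = cos (gamma * (PI / 2)) - Ci * sin (gamma * (PI / 2))).
  { unfold cis. rewrite cos_neg, sin_neg. apply injective_projections; simpl; ring. }
  rewrite Hg.
  pose proof (cis_mult_opp (IZR k * acot x)) as Hc.
  replace (- (IZR k * acot x))%R with (- IZR k * acot x)%R in Hc by ring.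
  assert (HD : RtoC (4 - IZR k ^ 2) <> 0).
  { apply RtoC_neq_0. replace (4 - IZR k ^ 2)%R with (- ((IZR k + 2) * (IZR k - 2)))%R by ring.
    apply Ropp_neq_0_compat, Rmult_integral_contrapositive_currified; assumption. }
  replace (4 - IZR k ^ 2) with (RtoC (4 - IZR k ^ 2))
    by (rewrite RtoC_minus, RtoC_pow; reflexivity).
  replace (2 + IZR k) with (RtoC (IZR k + 2)) by (rewrite RtoC_plus; ring).
  rewrite plus_IZR, (RtoC_mult (IZR k) (4 - _)), (RtoC_mult (IZR k) (_ + 2)), (RtoC_mult (PI / 2)), RtoC_div by lra.
  apply RtoC_neq_0 in H0. apply RtoC_neq_0 in H2.
  pose proof PI_neq_0_C as HP.
  assert (H4 : RtoC 4 <> 0) by (apply RtoC_neq_0; lra).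
  assert (H5 : RtoC 2 <> 0) by (apply RtoC_neq_0; lra).
  assert (Hi : Ci * Ci = - (1)) by (apply injective_projections; simpl; ring).
  revert Hc HD H0 H2 HP Hi.
  generalize Ci, (cis (IZR k * acot x)), (cis (- IZR k * acot x)), (RtoC (4 - IZR k ^ 2)),
    (RtoC (IZR k + 2)), (RtoC PI), (RtoC (IZR k)), (closed_form (acot x) k),
    (RtoC (sin (acot x) ^ 2)), (RtoC (cos (gamma * (PI / 2)))),
    (RtoC (sin (gamma * (PI / 2)))).
  intros i e e' d m p K v q c g Hc HD H0 H2 HP Hi.
  symmetry.
  transitivity (K * (c - i * g) * q * e
    + c * (2 * i / (p * m) + 2 * i * K * e / p * v + i * i * K * e * q
           - 2 * i * (e * e') / (p * m))).
  - replace (RtoC 8) with (RtoC 2 * RtoC 4) by (rewrite <- RtoC_mult; f_equal; ring).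
    field. auto.
  - rewrite Hi, Hc. unfold Cdiv. ring.
Qed.

(** * Back to the variable [x] *)

Lemma acot_cot s : (0 < s < PI)%R -> acot (cot s) = s.
Proof.
  intros Hs. unfold acot, cot.
  replace (cos s / sin s)%R with (tan (PI / 2 - s))
    by (unfold tan; rewrite sin_shift, cos_shift; reflexivity).
  rewrite atan_tan by lra. ring.
Qed.

Lemma lcot_ln s : (0 < s < PI)%R -> lcot s = ln (cot (s / 2)).
Proof.
  intros Hs. unfold lcot, cot.
  assert (H1 : (0 < sin (s / 2))%R) by (apply sin_gt_0; lra).
  assert (H2 : (0 < cos (s / 2))%R) by (apply cos_gt_0; lra).
  replace ((1 + cos s) / (1 - cos s))%R with ((cos (s / 2) / sin (s / 2)) ^ 2)%R.
  - rewrite ln_pow by now apply Rdiv_lt_0_compat. simpl INR. field.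
  - replace (1 + cos s)%R with (2 * cos (s / 2) ^ 2)%R.
    + replace (1 - cos s)%R with (2 * sin (s / 2) ^ 2)%R; [field; lra|].
      replace s with (2 * (s / 2))%R at 2 by field. rewrite cos_2a_sin. ring.
    + replace s with (2 * (s / 2))%R at 2 by field. rewrite cos_2a_cos. ring.
Qed.

Lemma cos_acot x : cos (acot x) = (x / sqrt (1 + x ^ 2))%R.
Proof. unfold acot. now rewrite cos_shift, sin_atan, Rsqr_pow2. Qed.

(** With [r = sqrt (1 + x^2)]: [(r + x) / (r - x) = (r + x)^2] because
    [r^2 - x^2 = 1]. *)
Lemma lcot_acot x : lcot (acot x) = arcsinh x.
Proof.
  unfold lcot, arcsinh. rewrite cos_acot.
  pose proof (one_plus_sq_pos x) as H1. pose proof (sqrt_lt_R0 _ H1) as H2.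
  pose proof (pow2_sqrt (1 + x ^ 2) ltac:(lra)) as H3.
  replace (x ^ 2 + 1)%R with (1 + x ^ 2)%R by ring.
  set (r := sqrt (1 + x ^ 2)) in *.
  assert (Hx : (- r < x < r)%R) by (split; nra).
  replace ((1 + x / r) / (1 - x / r))%R with ((x + r) ^ 2)%R.
  - rewrite ln_pow by lra. simpl INR. field.
  - apply (Rmult_eq_reg_r (r - x)); [|lra].
    transitivity (x + r)%R; [|field; lra].
    transitivity ((x + r) * (r ^ 2 - x ^ 2))%R; [ring|]. rewrite H3. ring.
Qed.

Lemma Cexp_cis (z : C) (t : R) : z = (0%R, t) -> Cexp z = cis t.
Proof.
  intros ->. unfold Cexp, cis. simpl. rewrite exp_0.
  apply injective_projections; simpl; ring.
Qed.

Lemma Cexp_skew (gamma : R) : Cexp (- Ci * gamma * (PI / 2)) = cis (- (gamma * (PI / 2))).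
Proof. apply Cexp_cis, injective_projections; simpl; field. Qed.

Lemma Cpowz_over_Rpower (x : R) k :
  Cpowz (x + Ci) k / Rpower (1 + x ^ 2) (1 + IZR k / 2)
  = (sin (acot x) ^ 2)%R * cis (IZR k * acot x).
Proof.
  rewrite <- phi_cis. unfold phi.
  rewrite Rpower_plus, Rpower_1 by apply one_plus_sq_pos.
  rewrite sin2_acot, RtoC_mult, RtoC_inv by apply one_plus_sq_neq_0.
  field. split; apply RtoC_neq_0; [apply Rgt_not_eq, exp_pos | apply one_plus_sq_neq_0].
Qed.

Lemma one_plus_Csq (x : R) : 1 + RtoC x ^ 2 = RtoC (1 + x ^ 2).
Proof. now rewrite RtoC_plus, RtoC_pow. Qed.

Lemma x_plus_i_sq (x : R) : Cpow (x + Ci) 2 / (1 + x ^ 2) = cis (2 * acot x).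
Proof.
  rewrite <- phi_cis. unfold phi. rewrite one_plus_Csq.
  replace (2 / 2)%R with 1%R by field. now rewrite Rpower_1 by apply one_plus_sq_pos.
Qed.

Lemma sum_n_Cmult (c : C) (a : nat -> C) N :
  sum_n (fun n => c * a n) N = c * sum_n a N.
Proof.
  induction N as [|N IH].
  - now rewrite !sum_O.
  - rewrite !sum_Sn, IH. change (@plus C_AbelianMonoid) with Cplus.
    as_C_eq. ring.
Qed.

Lemma cubic_C n :
  (2 * INR n - 1) * (2 * INR n + 1) * (2 * INR n + 3) = RtoC (cubic n).
Proof. unfold cubic. now rewrite !RtoC_mult, RtoC_minus, !RtoC_plus, !RtoC_mult. Qed.

Theorem lemma3p1 :
  forall (k : Z) (gamma : R), Z.Odd k -> (Rabs gamma <= 1)%R ->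
  (forall x : R,
     is_Riesz_Feller gamma (phi k) x
       (IZR k * Cexp (- Ci * gamma * (PI / 2)) * Cpowz (x + Ci) k
          / Rpower (1 + x ^ 2) (1 + IZR k / 2)
        + cos (gamma * (PI / 2))
          * (2 * Ci / (PI * (2 + IZR k))
             - 8 * Ci / (PI * (4 - IZR k ^ 2))
               * hyp2F1 1 (- 1 - IZR k / 2) (2 - IZR k / 2)
                   (Cpow (x + Ci) 2 / (1 + x ^ 2))))
     /\
     is_Riesz_Feller gamma (phi k) x
       (cos (gamma * (PI / 2))
        * (2 * Ci * IZR (Z.sgn k) / (PI * (2 + IZR (Z.abs k)))
           + 2 * Ci * IZR k * Cpowz (x + Ci) k
             * (x * sqrt (1 + x ^ 2) + arcsinh x)
             / (PI * Rpower (1 + x ^ 2) (1 + IZR k / 2))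
           + sum_n (fun n : nat =>
               8 * Ci * IZR k
               * Cpowz (x + Ci) (k - Z.sgn k * (2 * Z.of_nat n + 1))
               / (PI * (2 * INR n - 1) * (2 * INR n + 1) * (2 * INR n + 3)
                  * Rpower (1 + x ^ 2)
                      (IZR (k - Z.sgn k * (2 * Z.of_nat n + 1)) / 2)))
               (Z.to_nat ((Z.abs k - 1) / 2)))
        - sin (gamma * (PI / 2))
          * (Ci * IZR k * Cpowz (x + Ci) k
             / Rpower (1 + x ^ 2) (1 + IZR k / 2))))
  /\
  (forall s : R, (0 < s < PI)%R ->
     is_Riesz_Feller gamma (phi k) (cot s)
       (IZR k * Cexp (- Ci * gamma * (PI / 2)) * (sin s ^ 2)%R
          * Cexp (Ci * IZR k * s)
        + cos (gamma * (PI / 2))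
          * (2 * Ci / (PI * (2 + IZR k))
             - 8 * Ci / (PI * (4 - IZR k ^ 2))
               * hyp2F1 1 (- 1 - IZR k / 2) (2 - IZR k / 2)
                   (Cexp (Ci * 2 * s))))
     /\
     is_Riesz_Feller gamma (phi k) (cot s)
       (cos (gamma * (PI / 2))
        * (2 * Ci * IZR (Z.sgn k) / (PI * (2 + IZR (Z.abs k)))
           + 2 * Ci * IZR k * Cexp (Ci * IZR k * s) / PI
             * (cos s + (sin s ^ 2)%R * ln (cot (s / 2))
                + sum_n (fun n : nat =>
                    4 * Cexp (- Ci * IZR (Z.sgn k) * (2 * INR n + 1) * s)
                    / ((2 * INR n - 1) * (2 * INR n + 1) * (2 * INR n + 3)))
                    (Z.to_nat ((Z.abs k - 1) / 2))))
        - sin (gamma * (PI / 2))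
          * (Ci * IZR k * (sin s ^ 2)%R * Cexp (Ci * IZR k * s)))).

Proof.
  intros k gamma Hk _. split.
  - intros x. rewrite Cexp_skew, x_plus_i_sq. split.
    + refine (eq_ind _ _ (Riesz_Feller_hyp gamma k x Hk) _ _).
      f_equal. unfold Cdiv. rewrite <- !Cmult_assoc. do 2 f_equal.
      symmetry. apply Cpowz_over_Rpower.
    + refine (eq_ind _ _ (Riesz_Feller_sum gamma k x Hk) _ _).
      assert (E : Ci * IZR k * Cpowz (x + Ci) k / Rpower (1 + x ^ 2) (1 + IZR k / 2)
        = Ci * IZR k * (sin (acot x) ^ 2)%R * cis (IZR k * acot x)).
      { rewrite <- (Cmult_assoc _ (RtoC (sin _ ^ 2))), <- Cpowz_over_Rpower. unfold Cdiv. ring. }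
      rewrite E. f_equal. f_equal. rewrite <- Cplus_assoc. f_equal.
      rewrite Cmult_plus_distr_l, <- sum_n_Cmult. f_equal.
      * replace (cos (acot x) + sin (acot x) ^ 2 * lcot (acot x))%R
          with (sin (acot x) ^ 2 * (x * sqrt (1 + x ^ 2) + arcsinh x))%R.
        -- transitivity (2 * IZR k * (x * sqrt (1 + x ^ 2) + arcsinh x) / PI *
             (Cpowz (x + Ci) k / Rpower (1 + x ^ 2) (1 + IZR k / 2)) * Ci).
           ++ rewrite Cpowz_over_Rpower, !RtoC_mult, !RtoC_plus, !RtoC_mult.
              unfold Cdiv. ring.
           ++ field. split; [apply RtoC_neq_0, Rgt_not_eq, exp_pos | exact PI_neq_0_C].
        -- rewrite lcot_acot, sin2_acot, cos_acot.
           pose proof (one_plus_sq_pos x) as H1. pose proof (sqrt_lt_R0 _ H1) as H2.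
           pose proof (pow2_sqrt (1 + x ^ 2) ltac:(lra)) as H3.
           rewrite <- H3 at 1 4. field. lra.
      * apply sum_n_ext. intros n. as_C_eq. unfold sum_term.
        set (j := (k - Z.sgn k * (2 * Z.of_nat n + 1))%Z).
        transitivity (8 * Ci * IZR k / PI * phi j x / RtoC (cubic n)).
        -- rewrite phi_cis. unfold j.
           replace (IZR (k - Z.sgn k * (2 * Z.of_nat n + 1)) * acot x)%R
             with (IZR k * acot x + - IZR (Z.sgn k) * (2 * INR n + 1) * acot x)%R
             by (rewrite minus_IZR, mult_IZR, plus_IZR, mult_IZR, <- INR_IZR_INZ; ring).
           rewrite cis_plus. replace (RtoC 8) with (2 * 4) by (rewrite <- RtoC_mult; f_equal; ring).
           unfold Cdiv. ring.
        -- unfold phi. rewrite <- cubic_C.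
           destruct (cubic_neq_0 n) as (H1 & H2 & H3).
           field. repeat split; try apply PI_neq_0_C;
             try (apply RtoC_neq_0, Rgt_not_eq, exp_pos);
             rewrite <- ?RtoC_mult, <- ?RtoC_plus, <- ?RtoC_minus; now apply RtoC_neq_0.
  - intros s Hs. pose proof (acot_cot s Hs) as Es. rewrite Cexp_skew.
    rewrite (Cexp_cis (Ci * IZR k * s) (IZR k * s))
      by (apply injective_projections; simpl; ring).
    rewrite (Cexp_cis (Ci * 2 * s) (2 * s))
      by (apply injective_projections; simpl; ring).
    split.
    + pose proof (Riesz_Feller_hyp gamma k (cot s) Hk) as H. rewrite Es in H. exact H.
    + pose proof (Riesz_Feller_sum gamma k (cot s) Hk) as H. rewrite Es in H.
      rewrite lcot_ln, RtoC_plus, RtoC_mult in H by exact Hs.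
      refine (eq_ind _ _ H _ _). f_equal. do 4 f_equal.
      apply sum_n_ext. intros n. as_C_eq. unfold sum_term. rewrite cubic_C. do 2 f_equal.
      symmetry. apply Cexp_cis, injective_projections; simpl; ring.
Qed.
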